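(* Let $(F,s)$ be a primitive, recognisable mixed substitution system on a finite alphabet $\mathcal{A}$. For $i\ge 0$ let $K_i=K_{F,\sigma^i(s)}$ be the Barge–Diamond complex of $(F,\sigma^i(s))$ and let $f_i\colon K_{i+1}\to K_i$ be the continuous map induced by the substitution $\phi_{s_i}$. Then there is a homeomorphism $$\Omega_{F,s}\cong\varprojlim(K_i,f_i).$$
   Context: Let $\mathcal{A}$ be a finite alphabet, $\mathcal{A}^*=\bigcup_{n\ge 1}\mathcal{A}^n$. A substitution is a map $\phi\colon\mathcal{A}\to\mathcal{A}^*$, extended to words and to bi-infinite sequences by concatenation: $\phi(\dots a_{-1}\cdot a_0a_1\dots)=\dots\phi(a_{-1})\cdot\phi(a_0)\phi(a_1)\dots$, the dot marking the boundary between positions $-1$ and $0$. Its matrix $M_\phi$ has $(i,j)$ entry the number of occurrences of the $i$th letter in the image under $\phi$ of the $j$th letter. A mixed substitution system is a pair $(F,s)$ with $F=\{\phi_0,\dots,\phi_k\}$ a finite set of substitutions on $\mathcal{A}$ and $s=(s_0,s_1,\dots)\in\{0,\dots,k\}^{\mathbb{N}}$; $\sigma$ denotes the left shift, on $s$ and on $\mathcal{A}^{\mathbb{Z}}$. Write $\phi_{s[m,n]}=\phi_{s_m}\circ\cdots\circ\phi_{s_n}$, with matrix $M_{s[m,n]}$. The system is (weakly) primitive if for every $n\ge 0$ there is $k\ge 1$ such that $M_{s[n,n+k]}$ has strictly positive entries. A bi-infinite sequence is admitted by $(F,s)$ if each of its finite subwords is a subword of $\phi_{s[0,n]}(a)$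 for some $n\ge 0$, $a\in\mathcal{A}$. $\Sigma_{F,s}\subset\mathcal{A}^{\mathbb{Z}}$ is the space of admitted sequences, and $\mathcal{L}^2_{F,s}$ is the set of two-letter words occurring in elements of $\Sigma_{F,s}$. The tiling space is $\Omega_{F,s}=(\Sigma_{F,s}\times[0,1])/{\sim}$ with $(\mathcal{T},1)\sim(\sigma(\mathcal{T}),0)$. Put $\Omega_i=\Omega_{F,\sigma^i(s)}$. The continuous map $\phi_{s_i}\colon\Omega_{i+1}\to\Omega_i$ sends $(\mathcal{T},t)$, with $t\in[0,1)$ and $\mathcal{T}=\dots a_{-1}\cdot a_0a_1\dots$, to $(\sigma^{\lfloor\tilde t\rfloor}(\phi_{s_i}(\mathcal{T})),\tilde t-\lfloor\tilde t\rfloor)$, where $\tilde t=|\phi_{s_i}(a_0)|\,t$. The system is recognisable if all these maps, $i\ge 0$, are injective. Barge–Diamond complex: let $\epsilon=\min_{a\in\mathcal{A},\phi\in F}\frac{1}{2|\phi(a)|}$, $e_a=[\epsilon,1-\epsilon]\times\{a\}$ for $a\in\mathcal{A}$, and $e_{ab}=[-\epsilon,\epsilon]\times\{ab\}$ for $ab\in\mathcal{L}^2_{F,s}$. Then $K_{F,s}=\left(\bigcup_{a\in\mathcal{A}}e_a\cup\bigcup_{ab\in\mathcal{L}^2_{F,s}}e_{ab}\right)/{\sim}$, where $(1-\epsilon,a)\sim(-\epsilon,ab)\sim(-\epsilon,ac)$ and $(\epsilon,a)\sim(\epsilon,ba)\sim(\epsilon,ca)$ for all $a,b,c\in\mathcal{A}$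 for which these edges exist. Define $p_i\colon\Omega_i\to K_i$ for $t\in[0,1)$ and $\mathcal{T}=\dots a_{-1}\cdot a_0a_1\dots$ by $p_i(\mathcal{T},t)=(t,a_{-1}a_0)$ if $t\in[0,\epsilon]$, $(t,a_0)$ if $t\in[\epsilon,1-\epsilon]$, and $(t-1,a_0a_1)$ if $t\in[1-\epsilon,1)$. The map $f_i\colon K_{i+1}\to K_i$ is the unique continuous map with $f_i\circ p_{i+1}=p_i\circ\phi_{s_i}$.
   Formalization: The formal theorem additionally assumes that the space of admitted sequences is nonempty; this is automatic for alphabets of two or more letters, and without it the claim fails, e.g. for the identity substitution on one letter, where the tiling space is empty but the inverse limit is a point. *)

(* Defs.v *)
From HB Require Import structures.
From Stdlib Require Import Relations.Relation_Operators.
From mathcomp Require Import all_boot all_order all_algebra.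
From mathcomp Require Import all_classical all_reals.
From mathcomp Require Import zify lra.
From mathcomp Require Import topology normedtype.

Set Implicit Arguments.
Unset Strict Implicit.
Unset Printing Implicit Defensive.

Import Order.TTheory GRing.Theory Num.Theory.
Import numFieldNormedType.Exports.

Local Open Scope classical_set_scope.
Local Open Scope ring_scope.
Local Open Scope quotient_scope.

(** * Topological preliminaries *)

Definition homeomorphic (X Y : topologicalType) : Prop :=
  exists (f : X -> Y) (g : Y -> X),
    [/\ continuous f, continuous g, cancel f g & cancel g f].

Section Quotient.
Context (T : topologicalType) (r : T -> T -> Prop).

Definition eqclos (x y : T) : bool := `[< clos_refl_sym_trans T r x y >].

Lemma eqclos_refl : reflexive eqclos.
Proof. by move=> x; apply/asboolP; exact: rst_refl. Qed.

Lemma eqclos_sym : symmetric eqclos.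
Proof. by move=> x y; apply/asboolP/asboolP; exact: rst_sym. Qed.

Lemma eqclos_trans : transitive eqclos.
Proof.
by move=> y x z /asboolP xy /asboolP yz; apply/asboolP; exact: rst_trans xy yz.
Qed.

Definition eqclos_equiv : equiv_rel T :=
  EquivRel eqclos eqclos_refl eqclos_sym eqclos_trans.

(* [T] modulo the equivalence relation generated by [r]. *)
Definition quot : topologicalType :=
  quotient_topology {eq_quot eqclos_equiv}.

Definition cls (x : T) : quot := \pi_({eq_quot eqclos_equiv}) x.
Definition rep (x : quot) : T := repr (x : {eq_quot eqclos_equiv}).

Lemma repK : cancel rep cls.
Proof. exact: reprK. Qed.

End Quotient.

Definition invlim (X : nat -> topologicalType) (f : forall i, X i.+1 -> X i) :
    topologicalType :=
  set_type [set x : prod_topology X | forall i, f i (x i.+1) = x i].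

(** * Substitutions *)

Record substitution (A : finType) := Substitution {
  subst_letter :> A -> seq A;
  subst_neq0 : forall a, subst_letter a != [::] }.

(* The space of bi-infinite sequences over [A]. *)
Definition biinf (A : finType) : topologicalType :=
  prod_topology (fun _ : int => discrete_topology A).

Section Words.
Context (A : finType).
Implicit Types (T : biinf A) (f : substitution A).

Definition subst_word f (w : seq A) : seq A := flatten [seq f a | a <- w].

(* The subword of [T] of length [n] starting at position [m]. *)
Definition subword T (m : int) (n : nat) : seq A :=
  [seq (T (m + i%:Z) : A) | i <- iota 0 n].

Definition shift (z : int) T : biinf A := fun n => T (n + z).

(* As images of letters are nonempty, the letter at position [n >= 0] of the
   image of [T] already occurs in the image of [T 0 .. T n], and the letter at
   position [- (n + 1)] in the image of [T (- (n + 1)) .. T (- 1)], where it is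
   the [n]th one from the right; the default value of [nth] is never used. *)
Definition subst_biinf f T : biinf A := fun z =>
  match z with
  | Posz n => nth (T 0 : A) (subst_word f (subword T 0 n.+1)) n
  | Negz n =>
      nth (T 0 : A) (rev (subst_word f (subword T (- n.+1%:Z) n.+1))) n
  end.

Lemma subword_cat T m n p :
  subword T m (n + p) = subword T m n ++ subword T (m + n%:Z) p.
Proof.
rewrite /subword iotaD map_cat add0n; congr (_ ++ _).
rewrite -[n in iota n p]addn0 iotaDl -map_comp.
by apply: eq_map => i /=; rewrite PoszD addrA.
Qed.

Lemma size_subword T m n : size (subword T m n) = n.
Proof. by rewrite size_map size_iota. Qed.

Lemma subst_word_cat f v w :
  subst_word f (v ++ w) = subst_word f v ++ subst_word f w.
Proof. by rewrite /subst_word map_cat flatten_cat. Qed.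

Lemma size_subst_word f w : (size w <= size (subst_word f w))%N.
Proof.
elim: w => //= a w IH; rewrite /subst_word /= size_cat -add1n leq_add //.
by rewrite lt0n size_eq0 subst_neq0.
Qed.

Lemma infix_subst_word f v w :
  infix v w -> infix (subst_word f v) (subst_word f w).
Proof.
by move=> /infixP[p [q ->]]; rewrite !subst_word_cat; apply/infixP; do 2 eexists.
Qed.

Lemma subst_biinfE f T (N : nat) (z : int) : - N%:Z <= z -> z < N%:Z ->
  let W := subst_word f (subword T (- N%:Z) N) in
  subst_biinf f T z =
  nth (T 0 : A) (W ++ subst_word f (subword T 0 N)) (absz ((size W)%:Z + z)%R).
Proof.
move=> Nz zN W.
have sW : (N <= size W)%N.
  by rewrite -[X in (X <= _)%N](size_subword T (- N%:Z)) size_subst_word.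
case: z Nz zN => n Nz zN; rewrite [LHS]/=.
  have -> : (absz ((size W)%:Z + Posz n)%R) = (size W + n)%N by lia.
  rewrite nth_cat ltnNge leq_addr /= addKn.
  have nN : (n < N)%N by lia.
  rewrite -(subnKC nN) subword_cat subst_word_cat nth_cat.
  by rewrite (leq_trans _ (size_subst_word _ _)) ?size_subword.
have nN : (n < N)%N by lia.
have -> : (absz ((size W)%:Z + Negz n)%R) = (size W - n.+1)%N by lia.
rewrite nth_cat ifT; last by lia.
rewrite -nth_rev; last by lia.
have -> : W = subst_word f (subword T (- N%:Z) (N - n.+1)) ++
              subst_word f (subword T (- n.+1%:Z) n.+1).
  rewrite -subst_word_cat /W.
  have -> : - n.+1%:Z = - N%:Z + (N - n.+1)%N%:Z by lia.
  by rewrite -subword_cat subnK.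
rewrite rev_cat nth_cat size_rev.
by rewrite (leq_trans _ (size_subst_word _ _)) ?size_subword.
Qed.

Lemma infix_subst_biinf f T m n :
  exists m' n', infix (subword (subst_biinf f T) m n)
                      (subst_word f (subword T m' n')).
Proof.
pose N := (absz m + n)%N; exists (- N%:Z), (N + N)%N.
rewrite subword_cat addNr subst_word_cat.
set W := subst_word f (subword T (- N%:Z) N).
set V := subst_word f (subword T 0 N).
have sW : (N <= size W)%N.
  by rewrite -[X in (X <= _)%N](size_subword T (- N%:Z)) size_subst_word.
have sV : (N <= size V)%N.
  by rewrite -[X in (X <= _)%N](size_subword T 0) size_subst_word.
suff -> : subword (subst_biinf f T) m n =
    take n (drop (absz ((size W)%:Z + m)%R) (W ++ V)).
  by apply: (@infix_trans _ (drop (absz ((size W)%:Z + m)%R) (W ++ V)));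
    [exact: infix_take | exact: infix_drop].
have sz : (n <= size (drop (absz ((size W)%:Z + m)%R) (W ++ V)))%N.
  by rewrite size_drop size_cat; lia.
apply: (@eq_from_nth _ (T 0 : A)) => [|i].
  by rewrite size_subword size_takel.
rewrite size_subword => ilt; rewrite nth_take // nth_drop.
rewrite (nth_map 0%N) ?size_iota // nth_iota // add0n.
rewrite (@subst_biinfE _ _ N); [|lia|lia].
by rewrite -/W -/V; congr nth; lia.
Qed.

Lemma subword_shift z T m n : subword (shift z T) m n = subword T (m + z) n.
Proof. by apply: eq_map => i; rewrite /shift addrAC. Qed.

End Words.

(** * Mixed substitution systems *)

Section System.
Context (A : finType) (k : nat) (F : 'I_k.+1 -> substitution A).
Implicit Types (s : nat -> 'I_k.+1).

Definition sshift s : nat -> 'I_k.+1 := fun n => s n.+1.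

(* The composite of the substitutions of indices [s m, .., s n]
   (the identity if [n < m]). *)
Definition subst_comp s (m n : nat) (a : A) : seq A :=
  foldr (fun i => subst_word (F (s i))) [:: a] (iota m (n.+1 - m)).

Definition subst_mx (g : A -> seq A) : 'M[nat]_#|A| :=
  \matrix_(i, j) count_mem (enum_val i) (g (enum_val j)).

Definition primitive s : Prop :=
  forall n, exists2 l, (1 <= l)%N &
    forall i j, (0 < subst_mx (subst_comp s n (n + l)) i j)%N.

(* This is empty in degenerate cases, e.g. for the identity substitution on a
   one-letter alphabet, although that system is primitive. *)
Definition Sigma s : set (biinf A) :=
  [set T | forall m n, exists l a, infix (subword T m n) (subst_comp s 0 l a)].

Definition L2 s : set (A * A) :=
  [set ab | exists2 T, Sigma s T & exists m : int, (T m, T (m + 1)) = ab].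

Lemma Sigma_shift s z T : Sigma s T -> Sigma s (shift z T).
Proof. by move=> sT m n; rewrite subword_shift; exact: sT. Qed.

Lemma subst_compS s l a :
  subst_comp s 0 l.+1 a = subst_word (F (s 0)) (subst_comp (sshift s) 0 l a).
Proof.
rewrite /subst_comp !subn0 -[iota 0 l.+2]/(0%N :: iota (1 + 0) l.+1) iotaDl.
by rewrite [LHS]/= foldr_map.
Qed.

Lemma Sigma_subst s T :
  Sigma (sshift s) T -> Sigma s (subst_biinf (F (s 0)) T).
Proof.
move=> sT m n; have [m' [n' inf]] := infix_subst_biinf (F (s 0)) T m n.
have [l [a inf']] := sT m' n'; exists l.+1, a; rewrite subst_compS.
exact: infix_trans inf (infix_subst_word _ inf').
Qed.

(** * The tiling space *)

Section Space.
Context (R : realType).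

Definition Omega_pre s : topologicalType :=
  (set_type (Sigma s) * set_type `[0 : R, 1]%classic)%type.

Definition Omega_glue s (x y : Omega_pre s) : Prop :=
  [/\ \val x.2 = 1, \val y.2 = 0 & \val y.1 = shift 1 (\val x.1)].

Definition Omega s : topologicalType := quot (@Omega_glue s).

Definition Omega_mk s (T : biinf A) (t : R) (sT : Sigma s T)
    (t01 : 0 <= t <= 1) : Omega s :=
  @cls (Omega_pre s) (@Omega_glue s)
    (exist _ T (mem_set sT), exist _ t (mem_set t01)).

(* The representative [(T, t)] of a class with [t] in [[0, 1)]. *)
Definition tile_nf s (x : Omega_pre s) : biinf A * R :=
  if \val x.2 == 1 then (shift 1 (\val x.1), 0) else (\val x.1, \val x.2).

Definition Omega_nf s (x : Omega s) : biinf A * R := tile_nf (rep x).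

Lemma Omega_nfP s (x : Omega s) :
  Sigma s (Omega_nf x).1 /\ 0 <= (Omega_nf x).2 < 1.
Proof.
rewrite /Omega_nf /tile_nf; case: (rep x) => -[T sT] [t t01] /=.
move: sT t01 => /set_mem sT /set_mem; rewrite /= in_itv /= => /andP[t0 t1].
case: eqVneq => [_|tn1] /=; first by split; [exact: Sigma_shift | lra].
by split => //; rewrite t0 lt_neqAle tn1.
Qed.

Lemma tile_nf_eqclos s (x y : Omega_pre s) :
  eqclos (@Omega_glue s) x y -> tile_nf x = tile_nf y.
Proof.
move=> /asboolP; elim=> {x y} [x y [x1 y0 xy]|//|//|x y z _ -> _ -> //].
by rewrite /tile_nf x1 y0 xy eqxx eq_sym oner_eq0.
Qed.

Lemma Omega_mkK s T t (sT : Sigma s T) (t01 : 0 <= t <= 1) :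
  t < 1 -> Omega_nf (Omega_mk sT t01) = (T, t).
Proof.
move=> t1; rewrite /Omega_nf /Omega_mk.
rewrite -(@tile_nf_eqclos _ (exist _ T (mem_set sT), exist _ t (mem_set t01))).
  by rewrite /tile_nf /= lt_eqF.
have /eqquotP := repK (Omega_mk sT t01).
by rewrite eqclos_sym.
Qed.

Definition subst_time s (x : Omega (sshift s)) : R :=
  (size (F (s 0) ((Omega_nf x).1 0)))%:R * (Omega_nf x).2.

Lemma subst_timeP s (x : Omega (sshift s)) :
  0 <= subst_time x - (Num.floor (subst_time x))%:~R <= 1.
Proof.
have := floor_itv (subst_time x); rewrite intrD => /andP[]; lra.
Qed.

(* The map induced by the substitution of index [s 0]. *)
Definition Omega_subst s (x : Omega (sshift s)) : Omega s :=
  Omega_mk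
    (Sigma_shift (Num.floor (subst_time x)) (Sigma_subst (Omega_nfP x).1))
    (subst_timeP x).

Definition recognisable s : Prop :=
  forall i, injective (@Omega_subst (iter i sshift s)).

(** * The Barge-Diamond complex *)

(* The neutral element 1/2 is an upper bound of all the terms. *)
Definition eps : R :=
  \big[Order.min/2^-1]_(x : 'I_k.+1 * A) (2 * (size (F x.1 x.2))%:R)^-1.

Definition label : Type := (A + A * A)%type.

Definition BD_edges s : set (R * discrete_topology label) :=
  [set x | match x.2 with
           | inl a => eps <= x.1 <= 1 - eps
           | inr ab => L2 s ab /\ - eps <= x.1 <= eps
           end].

Definition BD_glue s (x y : set_type (BD_edges s)) : Prop :=
  (exists a b, \val x = (1 - eps, inl a) /\ \val y = (- eps, inr (a, b))) \/
  (exists a b, \val x = (eps, inl a) /\ \val y = (eps, inr (b, a))).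

Definition BD s : topologicalType := quot (@BD_glue s).

Definition BD_coord (T : biinf A) (t : R) : R * discrete_topology label :=
  if t <= eps then (t, inr (T (-1), T 0))
  else if t <= 1 - eps then (t, inl (T 0))
  else (t - 1, inr (T 0, T 1)).

Lemma BD_coordP s (x : Omega s) :
  BD_edges s (BD_coord (Omega_nf x).1 (Omega_nf x).2).
Proof.
have [] := Omega_nfP x; case: (Omega_nf x) => T t /= sT /andP[t0 t1].
rewrite /BD_coord; case: (lerP t eps) => te /=.
  by split => /=; [exists T => //; exists (-1) | lra].
case: (lerP t (1 - eps)) => te' /=; first by rewrite /BD_edges /= (ltW te).
by split => /=; [exists T => //; exists 0 | lra].
Qed.

Definition BD_proj s (x : Omega s) : BD s :=
  @cls (set_type (BD_edges s)) (@BD_glue s)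
    (exist _ (BD_coord (Omega_nf x).1 (Omega_nf x).2)
       (mem_set (BD_coordP x))).

Definition BD_induced s (g : BD (sshift s) -> BD s) : Prop :=
  continuous g /\ forall x, g (BD_proj x) = BD_proj (Omega_subst x).

End Space.

End System.

Arguments sshift {k} s n.
Arguments BD_induced {A k} F R s g.

(* Main.v *)
(** The Barge-Diamond complex [BD] is the tiling space seen through a keyhole: the
    projection remembers the tile at the origin, the position of the origin in it,
    and the neighbouring tile when the origin is within [eps] of it. Recognisability
    and compactness make the substitution maps homeomorphisms, so that a tiling [x]
    has ancestors [x_i] of all levels; [x] is sent to the sequence of projections of
    the [x_i], and only injectivity of this map needs more than compactness. If two
    tilings have the same projections at all levels but differ, say, to the left of
    the origin, then the distance [p i] to the first disagreement at level [i] is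
    nonincreasing in [i], hence eventually constant. From then on the origin lies in
    the leftmost tile of its supertile and the letters up to the disagreement have
    images of length one. If [p i > 1] this contradicts the growth of iterated
    substitutions; if [p i = 1] the distances from the origin to the left end of its
    tiles get divided by the lengths of the images, so they tend to zero and the left
    neighbours are eventually seen by the projections, hence equal. *)
Require Import Defs.
From mathcomp Require Import all_boot all_order all_algebra.
From mathcomp Require Import all_classical all_reals.
From mathcomp Require Import zify lra.
From mathcomp Require Import topology normedtype.

Set Implicit Arguments.
Unset Strict Implicit.
Unset Printing Implicit Defensive.

Import Order.TTheory GRing.Theory Num.Theory.
Import numFieldNormedType.Exports.

Local Open Scope classical_set_scope.
Local Open Scope ring_scope.

(* Both normedtype and Defs define [shift]. *)
Local Notation shift := Defs.shift.

(** * Topology *)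

Lemma prod_topology_cvg (T I : Type) (Y : I -> topologicalType)
    (G : set_system T) {FG : Filter G} (f : T -> prod_topology Y)
    (l : prod_topology Y) :
  (forall i, (fun x => f x i) @ G --> l i) -> f @ G --> l.
Proof.
move=> cf; apply/cvg_sup => i A [B [[C oC <-] Cx] sBA].
by apply: filterS sBA _; apply: (cf i); apply: open_nbhs_nbhs.
Qed.

Lemma prod_topology_continuous (X : topologicalType) (I : Type)
    (Y : I -> topologicalType) (f : X -> prod_topology Y) :
  (forall i, continuous (fun x => f x i)) -> continuous f.
Proof. by move=> cf x; apply: prod_topology_cvg => i; exact: cf. Qed.

Lemma set_type_cvg (T : Type) (Y : topologicalType) (A : set Y)
    (G : set_system T) {FG : Filter G} (f : T -> set_type A) (l : set_type A) :
  (fun x => \val (f x)) @ G --> \val l -> f @ G --> l.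
Proof.
move=> cf B [_ [[C oC <-] Cx] sBA]; apply: filterS sBA _.
by apply: cf; apply: open_nbhs_nbhs.
Qed.

Lemma set_type_continuous (X Y : topologicalType) (A : set Y)
    (f : X -> set_type A) :
  continuous (fun x => \val (f x)) -> continuous f.
Proof. by move=> cf x; apply: set_type_cvg; exact: cf. Qed.

Lemma val_continuous (X : topologicalType) (A : set X) :
  continuous (\val : set_type A -> X).
Proof. exact: initial_continuous. Qed.

(** Points without disjoint neighbourhoods are sent by every continuous map to points of the same
    kind. *)
Lemma hausdorff_separated (X : topologicalType) :
  (forall x y : X, x <> y -> exists2 Z : topologicalType, hausdorff_space Z &
     exists2 f : X -> Z, continuous f & f x <> f y) ->
  hausdorff_space X.
Proof.
move=> sep x y clxy; apply: contrapT => /sep[Z hZ [f cf nf]].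
apply: nf; apply: hZ => U V Ux Vy.
by have [z [? ?]] := clxy _ _ (cf _ _ Ux) (cf _ _ Vy); exists (f z).
Qed.

Lemma compact_image (X Y : topologicalType) (f : X -> Y) (A : set X) :
  continuous f -> compact A -> compact (f @` A).
Proof. by move=> cf; apply: continuous_compact; apply: continuous_subspaceT. Qed.

Lemma compact_closed_map (X Y : topologicalType) (f : X -> Y) (A : set X) :
  compact [set: X] -> hausdorff_space Y -> continuous f -> closed A ->
  closed (f @` A).
Proof.
move=> cX hY cf clA; apply: compact_closed => //; apply: compact_image => //.
exact: subclosed_compact clA cX _.
Qed.

(** A continuous surjection from a compact onto a Hausdorff space is closed, hence a quotient map.
    With [g \o p = id] this gives inverses of bijections; with [p] the projection to the complex,
    the induced maps. *)
Lemma compact_quotient_continuous (X Y Z : topologicalType) (p : X -> Y)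
    (g : Y -> Z) :
  compact [set: X] -> hausdorff_space Y -> continuous p ->
  (forall y, exists x, p x = y) -> continuous (g \o p) -> continuous g.
Proof.
move=> cX hY cp sp cgp; apply/continuous_closedP => C clC.
have -> : g @^-1` C = p @` ((g \o p) @^-1` C).
  apply/seteqP; split=> [y gy|_ [x ? <-]] //.
  by have [x xy] := sp y; exists x; rewrite //= xy.
apply: compact_closed_map => //.
by move/continuous_closedP: cgp; exact.
Qed.

Lemma compact_bij_continuous (X Y : topologicalType) (f : X -> Y) (g : Y -> X) :
  compact [set: X] -> hausdorff_space Y -> continuous f ->
  cancel f g -> cancel g f -> continuous g.
Proof.
move=> cX hY cf fK gK; apply: compact_quotient_continuous cX hY cf _ _ => [y|].
  by exists (g y).
by have -> : g \o f = id by [apply/funext]; move=> x; exact: cvg_id.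
Qed.

(** Every cluster point of [y] will do: the sequence is eventually in [C j], which is closed. *)
Lemma compact_nested_closed (X : topologicalType) (y : nat -> X)
    (C : nat -> set X) :
  compact [set: X] -> (forall j, closed (C j)) ->
  (forall j i, (j <= i)%N -> C j (y i)) ->
  exists x, forall j, C j x.
Proof.
move=> cX clC Cy; have [x [_ clx]] := cX (y @ \oo) _ filterT.
exists x => j; apply: (clC j) => U Ux; rewrite setIC.
rewrite setIC; apply: clx => //; exists j => // i /= ji; exact: Cy.
Qed.

Lemma set_type_compact (X : topologicalType) (A : set X) :
  compact A -> compact [set: set_type A].
Proof.
move=> cA F PF _.
have FA : (\val @ F) A by apply: (@filterE _ F) => -[z zA] /=; exact: set_mem.
have [x [Ax clx]] := cA _ _ FA.
exists (exist _ x (mem_set Ax)); split => // U V FU.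
move=> [_ [[W oW <-] Wx] sWV].
have FU' : (\val @ F) (\val @` U).
  by apply: (filterS (F := F)) FU => z Uz; exists z.
have [_ [[z Uz <-] Wz]] := clx _ _ FU' (open_nbhs_nbhs (conj oW Wx)).
by exists z; split => //; exact: sWV.
Qed.

Lemma locally_constant_continuous (X Y : topologicalType) (f : X -> Y) :
  (forall x, \forall z \near x, f z = f x) -> continuous f.
Proof.
move=> cf x U Ux; apply: filterS (cf x) => z /= fz.
by rewrite /= fz; exact: nbhs_singleton.
Qed.

Lemma discrete_locally_constant (X : topologicalType) (Y : choiceType)
    (f : X -> discrete_topology Y) :
  continuous f -> forall x, \forall z \near x, f z = f x.
Proof. by move=> cf x; exact: (cf x _ (discrete_set1 (f x))). Qed.

Lemma near_eq_continuous_at (X Y : topologicalType) (f g : X -> Y) (x : X) :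
  (\forall z \near x, f z = g z) -> {for x, continuous g} ->
  {for x, continuous f}.
Proof.
move=> fg cg U; rewrite /= (nbhs_singleton fg) => Ux.
by apply: filterS2 fg (cg _ Ux) => z /= ->.
Qed.

(** Pasting along the level set [h x = c], off which a single branch is used on a whole
    neighbourhood. *)
Lemma if_continuous (R : realType) (X Y : topologicalType) (h : X -> R) (c : R)
    (f g : X -> Y) :
  continuous h -> continuous f -> continuous g ->
  (forall x, h x = c -> f x = g x) ->
  continuous (fun x => if h x <= c then f x else g x).
Proof.
move=> ch cf cg fg x; case: (ltgtP (h x) c) => hx.
- have hz : \forall z \near x, h z < c := ch x _ (lt_nbhsl hx).
  apply: near_eq_continuous_at (cf x).
  by apply: filterS hz => z /ltW ->.
- have hz : \forall z \near x, c < h z := ch x _ (lt_nbhsr hx).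
  apply: near_eq_continuous_at (cg x).
  by apply: filterS hz => z; rewrite ltNge => /negbTE ->.
- move=> U; rewrite /= hx lexx => Ux.
  have Ux' : nbhs (g x) U by rewrite -fg.
  have := cg x U Ux'; have := cf x U Ux; rewrite ?nbhs_simpl /=.
  move=> fU gU; apply: filterS2 fU gU => z /= fz gz.
  by case: ifP.
Qed.

Lemma pair_continuous_at (X Y Z : topologicalType) (f : X -> Y) (g : X -> Z) x :
  {for x, continuous f} -> {for x, continuous g} ->
  {for x, continuous (fun z => (f z, g z))}.
Proof. by move=> cf cg; exact: (cvg_pair cf cg). Qed.

(** * Quotients by generated equivalence relations *)

Section QuotientMaps.
Context (T : topologicalType) (r : T -> T -> Prop).
Local Notation cls := (@cls T r).

Lemma cls_continuous : continuous cls.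
Proof. exact: pi_continuous. Qed.

Lemma quot_continuous (Z : topologicalType) (f : quot r -> Z) :
  continuous (fun x => f (cls x)) -> continuous f.
Proof. by move=> cf; apply/quotient_continuous. Qed.

Lemma cls_eqP x y : cls x = cls y <-> Relation_Operators.clos_refl_sym_trans T r x y.
Proof.
split; first by move=> /eqquotP /asboolP.
by move=> xy; apply/eqquotP/asboolP.
Qed.

Lemma cls_eq x y : r x y -> cls x = cls y.
Proof. by move=> xy; apply/cls_eqP; exact: Relation_Operators.rst_step. Qed.

Lemma cls_inj (Z : Type) (f : T -> Z) :
  (forall x y, r x y -> f x = f y) -> forall x y, cls x = cls y -> f x = f y.
Proof. by move=> rf x y /cls_eqP; elim=> // ? ? ? _ -> _ ->. Qed.

Lemma rep_cls (Z : Type) (f : T -> Z) :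
  (forall x y, r x y -> f x = f y) -> forall x, f (rep (cls x)) = f x.
Proof. by move=> rf x; apply: cls_inj rf _ _ _; rewrite repK. Qed.

Lemma quot_compact : compact [set: T] -> compact [set: quot r].
Proof.
move=> cT; rewrite (_ : [set: _] = cls @` [set: T]).
  by apply: compact_image => //; exact: cls_continuous.
by apply/seteqP; split => // x _; exists (rep x) => //; exact: repK.
Qed.

(** Continuous functions to [Z] that respect [r] descend to the quotient, so it suffices that they
    separate the classes. *)
Lemma quot_hausdorff (Z : topologicalType) :
  hausdorff_space Z ->
  (forall x y : T, (forall f : T -> Z, continuous f ->
      (forall x y, r x y -> f x = f y) -> f x = f y) -> cls x = cls y) ->
  hausdorff_space (quot r).
Proof.
move=> hZ sep; apply: hausdorff_separated => x y nxy; exists Z => //.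
apply: contrapT => nf; apply: nxy; rewrite -(repK x) -(repK y).
apply: sep => f cf rf; apply: contrapT => fxy; apply: nf.
exists (fun z => f (rep z)) => //; apply: quot_continuous.
by rewrite (_ : (fun _ => _) = f) // ; apply/funext => z; exact: rep_cls.
Qed.

End QuotientMaps.

(** * Words and substitutions *)

Section Subwords.
Context (A : finType).
Implicit Types (T : biinf A) (f : substitution A).

Lemma nth_subword d T m n i : (i < n)%N ->
  nth d (subword T m n) i = T (m + i%:Z) :> A.
Proof. by move=> ilt; rewrite (nth_map 0%N) ?size_iota // nth_iota // add0n. Qed.

Lemma subword_eqP T T' m m' n :
  subword T m n = subword T' m' n <->
  forall i, (i < n)%N -> T (m + i%:Z) = T' (m' + i%:Z).
Proof.
split=> [TT' i ilt|TT'].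
  by rewrite -(nth_subword (T 0) T m ilt) TT' nth_subword.
apply: (@eq_from_nth _ (T 0)); rewrite !size_subword // => i ilt.
by rewrite !nth_subword // TT'.
Qed.

Lemma subword1 T m : subword T m 1 = [:: T m : A].
Proof. by rewrite /subword /= addr0. Qed.

Lemma subword_nth T m n d W o : (o + n <= size W)%N ->
  (forall i, (i < n)%N -> T (m + i%:Z) = nth d W (o + i) :> A) ->
  subword T m n = take n (drop o W).
Proof.
move=> oW TW; apply: (@eq_from_nth _ d).
  by rewrite size_subword size_takel // size_drop; lia.
by rewrite size_subword => i ilt; rewrite nth_subword // nth_take // nth_drop TW.
Qed.

Lemma infix_subword T m n m' n' :
  m' <= m -> m + n%:Z <= m' + n'%:Z -> infix (subword T m n) (subword T m' n').
Proof.
move=> mm' nn'; have [p mE] : exists p : nat, m = m' + p%:Z.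
  by exists (absz (m - m')); lia.
rewrite mE (_ : n' = p + (n + (n' - p - n)))%N; last by lia.
by rewrite !subword_cat; apply/infixP; do 2 eexists.
Qed.

Lemma subst_word1 f a : subst_word f [:: a] = f a.
Proof. by rewrite /subst_word /= cats0. Qed.

Lemma subst_letter_gt0 f a : (0 < size (f a))%N.
Proof. by rewrite lt0n size_eq0 subst_neq0. Qed.

(** By [subst_biinfE] the letters of the image can be computed in the image of any larger symmetric
    window; the image of the [N] letters left of the origin ends exactly at the origin. *)
Lemma subword_subst f T N M :
  subword (subst_biinf f T) (- (size (subst_word f (subword T (- N%:Z) N)))%:Z)
    (size (subst_word f (subword T (- N%:Z) (N + M)))) =
  subst_word f (subword T (- N%:Z) (N + M)).
Proof.
rewrite subword_cat addNr subst_word_cat.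
set W := subst_word f (subword T (- N%:Z) N).
set V := subst_word f (subword T 0 M).
have WE (P : nat) : (N <= P)%N -> subst_word f (subword T (- P%:Z) P) =
    subst_word f (subword T (- P%:Z) (P - N)) ++ W.
  move=> NP; rewrite -subst_word_cat (_ : - N%:Z = - P%:Z + (P - N)%N%:Z).
    by rewrite -subword_cat subnK.
  by lia.
have VE (P : nat) : (M <= P)%N -> subst_word f (subword T 0 P) =
    V ++ subst_word f (subword T (0 + M%:Z) (P - M)).
  by move=> MP; rewrite -subst_word_cat -subword_cat subnKC.
apply: (@eq_from_nth _ (T 0)); rewrite size_subword // => i ilt.
rewrite nth_subword //; rewrite size_cat in ilt.
(* A radius at least [N] and [M] that covers every position of [W ++ V]. *)
pose P := (N + M + (size W + size V))%N.
rewrite (@subst_biinfE _ _ _ P); [|rewrite /P; lia|rewrite /P; lia].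
rewrite WE; last by rewrite /P; lia.
rewrite VE; last by rewrite /P; lia.
rewrite -catA nth_cat ifF; last by rewrite size_cat; lia.
rewrite catA nth_cat ifT; last by rewrite !size_cat; lia.
by congr nth; rewrite size_cat; lia.
Qed.

Lemma subword_subst_right f T M :
  subword (subst_biinf f T) 0 (size (subst_word f (subword T 0 M))) =
  subst_word f (subword T 0 M).
Proof. exact: (subword_subst f T 0 M). Qed.

Lemma subword_subst_left f T N :
  subword (subst_biinf f T) (- (size (subst_word f (subword T (- N%:Z) N)))%:Z)
    (size (subst_word f (subword T (- N%:Z) N))) =
  subst_word f (subword T (- N%:Z) N).
Proof. by have := subword_subst f T N 0; rewrite addn0. Qed.

Lemma shiftD T m n : shift m (shift n T) = shift (m + n) T.
Proof. by apply/funext => z; rewrite /shift addrA. Qed.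

(** The same window of [T] is cut once before and once after the letter [T 0]; its image is then
    read from two origins that differ by the length of the image of that letter. *)
Lemma subst_biinf_shift f T :
  subst_biinf f (shift 1 T) = shift (size (f (T 0)))%:Z (subst_biinf f T).
Proof.
apply/funext => z.
have [N NE] : exists N, N = (absz z).+1 by eexists.
have E : - N.+1%:Z + 1 = - N%:Z by lia.
have := subword_subst f (shift 1 T) N.+1 N; have := subword_subst f T N N.+1.
rewrite !subword_shift E addSnnS.
set K := size (subst_word f (subword T (- N%:Z) (N + N.+1))).
have -> : subword T (- N%:Z) N.+1 = subword T (- N%:Z) N ++ [:: T 0 : A].
  by rewrite -addn1 subword_cat addNr subword1.
have KE : K = (size (subst_word f (subword T (- N%:Z) N)) + size (f (T 0)) +
    size (subst_word f (subword T 1 N)))%N.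
  rewrite /K subword_cat addNr -addn1 addnC subword_cat add0r subword1.
  by rewrite !subst_word_cat subst_word1 !size_cat addnA.
have s1 := size_subst_word f (subword T (- N%:Z) N).
have s2 := size_subst_word f (subword T 1 N).
rewrite !size_subword in s1 s2.
rewrite subst_word_cat subst_word1 size_cat.
move: KE s1 s2; set w := size (subst_word _ (subword T (- _) N)).
set b := size (f (T 0)); set v := size _ => KE s1 s2.
move=> <- /subword_eqP => /(_ (absz (z + w%:Z + b%:Z))) H.
rewrite /shift -[in LHS](_ : - (w + b)%N%:Z + (absz (z + w%:Z + b%:Z))%:Z = z);
  last by lia.
rewrite H; last by lia.
by congr (subst_biinf f T _); lia.
Qed.

Lemma subst_biinf_letter f T i : (i < size (f (T 0)))%N ->
  subst_biinf f T i%:Z = nth (T 0 : A) (f (T 0)) i.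
Proof.
move=> ilt; have := subword_subst_right f T 1.
rewrite subword1 subst_word1 => H; by rewrite -[in RHS]H nth_subword.
Qed.

Lemma near_subword (T : biinf A) m n :
  \forall T' \near T, subword T' m n = subword T m n.
Proof.
have H i : \forall T' \near T, T' (m + i%:Z) = T (m + i%:Z).
  have := @discrete_locally_constant (biinf A) A (fun T => T (m + i%:Z)).
  apply; exact: (@proj_continuous int (fun=> discrete_topology A)).
have H' : \forall T' \near T, forall i : 'I_n,
    T' (m + (i : nat)%:Z) = T (m + (i : nat)%:Z).
  exact: (@filter_forall (biinf A) _ (fun (i : 'I_n) (T' : biinf A) =>
    T' (m + (i : nat)%:Z) = T (m + (i : nat)%:Z)) (nbhs T) _ (fun i => H i)).
by apply: filterS H' => T' TT'; apply/subword_eqP => i ilt; exact: (TT' (Ordinal ilt)).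
Qed.

Lemma closed_subword (P : seq A -> Prop) m n :
  closed [set T : biinf A | P (subword T m n)].
Proof.
by move=> T /(_ _ (near_subword T m n))[T' [PT' TT']]; rewrite /= -TT'.
Qed.

Lemma biinf_compact : compact [set: biinf A].
Proof.
have := @tychonoff int (fun=> discrete_topology A) (fun=> setT)
  (fun=> @finite_compact (discrete_topology A) setT (@finite_finset A setT)).
by congr compact; apply/seteqP; split.
Qed.

End Subwords.

Section Iterates.
Context (A : finType) (k : nat) (F : 'I_k.+1 -> substitution A).
Implicit Types (s : nat -> 'I_k.+1).

(** Unlike [subst_comp] this acts on words, so that composites can be split at any level and
    distributed over concatenations. *)
Definition iter_subst s l w :=
  foldr (fun i => subst_word (F (s i))) w (iota 0 l).

Lemma iter_substS s l w :
  iter_subst s l.+1 w = subst_word (F (s 0)) (iter_subst (sshift s) l w).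
Proof.
by rewrite /iter_subst -[iota 0 l.+1]/(0%N :: iota (1 + 0) l) iotaDl /= foldr_map.
Qed.

Lemma iter_substD s l l' w :
  iter_subst s (l + l') w = iter_subst s l (iter_subst (iter l sshift s) l' w).
Proof.
elim: l s => // l IH s.
by rewrite addSn !iter_substS IH -iterSr.
Qed.

Lemma iter_subst_cat s l v w :
  iter_subst s l (v ++ w) = iter_subst s l v ++ iter_subst s l w.
Proof.
elim: l s => // l IH s.
by rewrite !iter_substS IH subst_word_cat.
Qed.

Lemma iter_subst_size s l w : (size w <= size (iter_subst s l w))%N.
Proof.
elim: l s => // l IH s.
by rewrite iter_substS (leq_trans (IH (sshift s))) // size_subst_word.
Qed.

Lemma iter_sshiftE s n i : iter n sshift s i = s (n + i)%N.
Proof. by elim: n i => // n IH i; rewrite iterS /sshift IH addSnnS. Qed.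

Lemma subst_comp_iter s n l a :
  subst_comp F s n (n + l) a = iter_subst (iter n sshift s) l.+1 [:: a].
Proof.
rewrite /subst_comp /iter_subst -addnS addKn -[n in iota n _]addn0 iotaDl.
rewrite foldr_map; elim: (iota 0 l.+1) => //= i w ->.
by rewrite iter_sshiftE.
Qed.

(** The form in which primitivity is used: a positive matrix entry is the occurrence of a letter. *)
Definition mixing s := forall n, exists l, forall a b,
  b \in iter_subst (iter n sshift s) l.+1 [:: a].

Lemma primitive_mixing s : primitive F s -> mixing s.
Proof.
move=> prim n; have [l _ Hl] := prim n; exists l => a b.
have := Hl (enum_rank b) (enum_rank a).
by rewrite mxE !enum_rankK subst_comp_iter -has_count has_pred1.
Qed.

Lemma mixing_shift s i : mixing s -> mixing (iter i sshift s).
Proof.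
move=> mix n; have [l Hl] := mix (n + i)%N; exists l => a b.
by rewrite -iterD.
Qed.

Lemma SigmaP s T : Sigma F s T <->
  forall m n, exists l a, infix (subword T m n) (iter_subst s l.+1 [:: a]).
Proof.
have E l a : subst_comp F s 0 l a = iter_subst s l.+1 [:: a].
  exact: (subst_comp_iter s 0 l a).
by split=> sT m n; have [l [a]] := sT m n; rewrite ?E => inf; exists l, a; rewrite ?E.
Qed.

Definition growing s := forall n, exists L, forall l, (L <= l)%N ->
  forall a, (n <= size (iter_subst s l [:: a]))%N.

Lemma growing_mixing s : mixing s -> Sigma F s !=set0 -> growing s.
Proof.
move=> mix [T /SigmaP sT] n; have [l [a /size_infix]] := sT 0 n.
rewrite size_subword => nl; have [l' Hl'] := mix l.+1.
exists (l.+1 + l'.+1)%N => m mL b; rewrite -(subnKC mL) !iter_substD.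
(* The remaining levels only contribute the nonempty word [v], of which the first letter
   suffices. *)
set v := iter_subst _ (m - _) _.
have : (0 < size v)%N by rewrite (leq_trans _ (iter_subst_size _ _ _)).
case: v => // c v _; rewrite -[c :: v]cat1s iter_subst_cat.
have := Hl' c a; case/splitPr => p q; rewrite -[a :: q]cat1s.
by rewrite !iter_subst_cat !size_cat -!addnA addnCA (leq_trans nl) ?leq_addr.
Qed.

Lemma size_subst_word_le f (w : seq A) :
  (size (subst_word f w) <= (\max_(a : A) size (f a)) * size w)%N.
Proof.
elim: w => //= a w IH; rewrite /subst_word /= size_cat mulnS leq_add //.
exact: (leq_bigmax (F := fun a => size (f a))).
Qed.

(** Removing the outermost substitution shortens words by at most the factor [C], the largest length
    of the image of a letter. *)
Lemma growing_sshift s : growing s -> growing (sshift s).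
Proof.
move=> grow n; pose C := (\max_(a : A) size (F (s 0%N) a))%N.
have [L HL] := grow (C * n).+1; exists L => l lL a.
have := HL _ (leqW lL) a; rewrite iter_substS.
have := size_subst_word_le (F (s 0%N)) (iter_subst (sshift s) l [:: a]).
rewrite -/C => h1 h2; have : (C * n < C * size (iter_subst (sshift s) l [:: a]))%N.
  exact: leq_trans h2 h1.
by rewrite ltn_mul2l => /andP[_ /ltnW].
Qed.

Lemma growing_iter s i : growing s -> growing (iter i sshift s).
Proof. by move=> gs; elim: i => //= i; exact: growing_sshift. Qed.

Lemma Sigma_windows s (T : biinf A) :
  (forall j : nat, exists l a,
    infix (subword T (- j%:Z) (j + j)) (iter_subst s l.+1 [:: a])) ->
  Sigma F s T.
Proof.
move=> H; apply/SigmaP => m n; have [l [a inf]] := H (absz m + n)%N.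
exists l, a; apply: infix_trans inf; apply: infix_subword; lia.
Qed.

Lemma Sigma_prefix s l b : mixing s -> growing s ->
  exists2 T, Sigma F s T &
    let w := iter_subst s l [:: b] in subword T 0 (size w) = w.
Proof.
move=> mix grow; set w := iter_subst s l [:: b].
have [l' Hl'] := mix l.
have key N : exists T : biinf A, subword T 0 (size w) = w /\
    forall j, (j <= N)%N -> exists l a,
      infix (subword T (- j%:Z) (j + j)) (iter_subst s l.+1 [:: a]).
  (* As [v] has more than [N + N] letters, its letter at index [N] has at least [N] letters on
     either side. *)
  have [L HL] := growing_iter (l + l'.+1) grow (N + N).+1.
  have := HL _ (leqnn L) b.
  set v := iter_subst _ L [:: b] => vN.
  have NvN : (N < size v)%N by lia.
  have vE : v = take N v ++ nth b v N :: drop N.+1 v.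
    by rewrite -drop_nth // cat_take_drop.
  have E : iter_subst s (l + l'.+1 + L) [:: b] = iter_subst s (l + l'.+1) v.
    exact: iter_substD.
  (* After [l'.+1] levels the image of that letter contains [b], hence after [l] more it contains
     [w]. *)
  have := Hl' (nth b v N) b; case/splitPr E' : _ / => [p q].
  move: E; rewrite vE -[_ :: drop _ _]cat1s !iter_subst_cat.
  rewrite (iter_substD s l l'.+1 [:: _]) E' -[b :: q]cat1s !iter_subst_cat -/w.
  set X := iter_subst s _ (take N v); set Y := iter_subst s _ (drop N.+1 v).
  set P := iter_subst s l p; set Q := iter_subst s l q.
  have sX : (N <= size X)%N.
    by rewrite (leq_trans _ (iter_subst_size _ _ _)) // size_takel // ltnW.
  have sY : (N <= size Y)%N.
    by rewrite (leq_trans _ (iter_subst_size _ _ _)) // size_drop; lia.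
  set Z := (X ++ _) => ZE.
  (* The occurrence of [w] in [Z] is placed at position 0. The letters outside [Z] do not matter:
     only [w] and windows of radius at most [N] are read, and these stay inside. *)
  exists (fun z => nth b Z (absz ((size (X ++ P))%:Z + z)%R)); split.
    rewrite (@subword_nth _ _ _ _ b Z (size (X ++ P))).
    - by rewrite /Z !catA -catA -catA drop_size_cat // take_size_cat.
    - by rewrite /Z !size_cat; lia.
    - by move=> i _; congr nth; lia.
  move=> j jN; exists (l + l' + L)%N, b.
  rewrite -addSn -addnS ZE.
  rewrite (@subword_nth _ _ _ _ b Z (size (X ++ P) - j)).
  - apply: infix_trans (infix_take _ _) (infix_drop _ _).
  - by rewrite /Z !size_cat; lia.
  - by move=> i _; congr nth; rewrite size_cat; lia.
have [y Hy] := choice key.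
have [|j|T HT] := @compact_nested_closed (biinf A) y
  (fun j => [set T | subword T 0 (size w) = w] `&`
            [set T | exists l a, infix (subword T (- j%:Z) (j + j))
                                       (iter_subst s l.+1 [:: a])])
  (@biinf_compact _).
- move=> j; apply: closedI; first exact: (@closed_subword A (fun v => v = w) 0 (size w)).
  exact: (@closed_subword A
    (fun v => exists l a, infix v (iter_subst s l.+1 [:: a]))).
- by move=> i ji; have [? H] := Hy i; split => //; exact: H.
- exists T; last by have [] := HT 0%N.
  by apply: Sigma_windows => j; have [] := HT j.
Qed.

End Iterates.

(** * The tiling space *)

Section Clamp.
Context (R : realType).
Implicit Types a b u : R.

(** The retraction of the line onto an interval, by which functions defined on intervals become
    total. *)
Definition clamp a b u := if u <= a then a else if u <= b then u else b.

Lemma clamp_itv a b u : a <= b -> a <= clamp a b u <= b.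
Proof. by rewrite /clamp => ab; case: (lerP u a); case: (lerP u b); lra. Qed.

Lemma clamp_id a b u : a <= u <= b -> clamp a b u = u.
Proof. by rewrite /clamp => ab; case: (lerP u a); case: (lerP u b); lra. Qed.

Lemma clamp_continuous a b : a <= b -> continuous (clamp a b).
Proof.
move=> ab; apply: if_continuous => [x|x||x ->]; try exact: cvg_id.
- exact: cvg_cst.
- apply: if_continuous => [x|x|x|x ->] //; try exact: cvg_id.
  exact: cvg_cst.
- by rewrite ab.
Qed.

End Clamp.

(** * The flow and the substitution maps on the tiling space *)

Section TilingSpace.
Context (R : realType) (A : finType) (k : nat) (F : 'I_k.+1 -> substitution A).
Implicit Types (s : nat -> 'I_k.+1).

Local Notation Sigma s := (set_type (Sigma F s)).
Local Notation I01 := (set_type `[0 : R, 1]%classic).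
Local Notation cls s := (@cls (Omega_pre F R s) (@Omega_glue A k F R s)).

Definition Sigma_sh s (z : int) (T : Sigma s) : Sigma s :=
  exist _ (shift z (\val T)) (mem_set (Sigma_shift z (set_valP T))).

Definition Sigma_sub s (T : Sigma (sshift s)) : Sigma s :=
  exist _ (subst_biinf (F (s 0)) (\val T)) (mem_set (Sigma_subst (set_valP T))).

Lemma I01P (t : I01) : 0 <= \val t <= 1.
Proof. by have := set_valP t; rewrite /= in_itv. Qed.

Definition to_I01 (u : R) : I01 := exist _ (clamp 0 1 u)
  (mem_set (clamp_itv u ler01 : (`[0, 1]%classic : set R) (clamp 0 1 u))).

Lemma Omega_nf_cls s (x : Omega_pre F R s) : Omega_nf (cls s x) = tile_nf x.
Proof. by apply: tile_nf_eqclos; apply/asboolP/cls_eqP; rewrite repK. Qed.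

Lemma cls_tile_nf s (x y : Omega_pre F R s) :
  tile_nf x = tile_nf y -> cls s x = cls s y.
Proof.
(* Every class has a representative whose coordinates are the normal form. *)
suff H z : exists w : Omega_pre F R s,
    cls s z = cls s w /\ (\val w.1, \val w.2) = tile_nf z.
  have [x' [-> <-]] := H x; have [y' [-> <-]] := H y.
  move=> [/val_inj xy1 /val_inj xy2]; congr (cls s _).
  by case: x' y' xy1 xy2 => [? ?] [? ?] /= -> ->.
case: z => T t; rewrite /tile_nf /=; case: eqP => t1; last by exists (T, t).
exists (Sigma_sh 1 T, to_I01 0); split => /=.
  by apply: cls_eq; split => //=; rewrite clamp_id // lexx ler01.
by rewrite clamp_id // lexx ler01.
Qed.

Lemma Omega_nf_inj s (x y : Omega F R s) : Omega_nf x = Omega_nf y -> x = y.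
Proof.
move=> xy; rewrite -(repK x) -(repK y); apply: cls_tile_nf.
by rewrite -!Omega_nf_cls !repK.
Qed.

Lemma frac_itv (u : R) : 0 <= u - (Num.floor u)%:~R < 1.
Proof. by have := floor_itv u; rewrite intrD => /andP[]; lra. Qed.

Lemma frac_itvW (u : R) : 0 <= u - (Num.floor u)%:~R <= 1.
Proof. by have /andP[-> /ltW ->] := frac_itv u. Qed.

(** The translation flow started at [(T, 0)], at any real time. It absorbs the gluing and the
    floors: points, shifts and substitution maps are all expressed by one continuous map. *)
Definition flow s (T : Sigma s) (u : R) : Omega F R s :=
  Omega_mk (Sigma_shift (Num.floor u) (set_valP T)) (frac_itvW u).

Lemma Omega_nf_flow s (T : Sigma s) u :
  Omega_nf (flow T u) =
  (shift (Num.floor u) (\val T), u - (Num.floor u)%:~R).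
Proof. by apply: Omega_mkK; have /andP[] := frac_itv u. Qed.

Lemma Omega_nf_subst s (x : Omega F R (sshift s)) :
  let u := (size (F (s 0%N) ((Omega_nf x).1 0)))%:R * (Omega_nf x).2 in
  Omega_nf (Omega_subst x) =
  (shift (Num.floor u) (subst_biinf (F (s 0%N)) (Omega_nf x).1),
   u - (Num.floor u)%:~R).
Proof. by apply: Omega_mkK; have /andP[] := frac_itv (subst_time x). Qed.

Lemma flow_shift s (T : Sigma s) (z : int) (u : R) :
  flow (Sigma_sh z T) u = flow T (z%:~R + u).
Proof.
apply: Omega_nf_inj; rewrite !Omega_nf_flow /= shiftD.
have -> : Num.floor (z%:~R + u) = z + Num.floor u.
  by apply: floor_def; have := floor_itv u; rewrite !intrD; lra.
by rewrite intrD addrC; congr (shift _ _, _); lra.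
Qed.

Lemma cls_flow s (T : Sigma s) (t : I01) : cls s (T, t) = flow T (\val t).
Proof.
apply: Omega_nf_inj; rewrite Omega_nf_flow Omega_nf_cls /tile_nf /=.
have /andP[t0 t1] := I01P t; case: eqP => [->|/eqP t1'].
  by rewrite floor1 subrr.
have -> : Num.floor (\val t) = 0.
  by apply: floor_def; rewrite /= t0 add0r lt_neqAle t1'.
rewrite subr0; congr (_, _).
by apply/funext => z; rewrite /shift addr0.
Qed.

(** For [t = 1] the normal form passes to the next tile, and [subst_biinf_shift] shows that the flow
    arrives at the same place. So continuity can be checked on all of [Omega_pre]. *)
Lemma Omega_subst_cls s (T : Sigma (sshift s)) (t : I01) :
  Omega_subst (cls (sshift s) (T, t)) =
  flow (Sigma_sub T) ((size (F (s 0%N) (\val T 0)))%:R * \val t).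
Proof.
apply: Omega_nf_inj; rewrite Omega_nf_subst Omega_nf_flow Omega_nf_cls.
rewrite /tile_nf; case: eqP => [/= ->|//].
rewrite mulr0 mulr1 floor0 subst_biinf_shift.
have -> : Num.floor ((size (F (s 0%N) (\val T 0)))%:R : R) =
    size (F (s 0%N) (\val T 0)).
  by apply: floor_def; rewrite intrD -!pmulrn; lra.
by rewrite shiftD add0r !subrr.
Qed.

Lemma biinf_letter_near (T : biinf A) z : \forall T' \near T, T' z = T z.
Proof.
have := @discrete_locally_constant (biinf A) A (fun T => T z).
by apply; exact: (@proj_continuous int (fun=> discrete_topology A)).
Qed.

Lemma subst_biinf_near (f : substitution A) (T : biinf A) z :
  \forall T' \near T, subst_biinf f T' z = subst_biinf f T z.
Proof.
have H0 := biinf_letter_near T 0.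
case: z => n.
  apply: filterS2 H0 (near_subword T 0 n.+1) => T' /= -> TT'.
  by rewrite [LHS]/= TT'.
apply: filterS2 H0 (near_subword T (- n.+1%:Z) n.+1) => T' /= -> TT'.
by rewrite [LHS]/= TT'.
Qed.

Lemma subst_biinf_continuous (f : substitution A) : continuous (subst_biinf f).
Proof.
apply: prod_topology_continuous => z; apply: locally_constant_continuous => T.
exact: subst_biinf_near.
Qed.

Lemma shift_continuous z : continuous (@Defs.shift A z).
Proof.
apply: prod_topology_continuous => n.
exact: (@proj_continuous int (fun=> discrete_topology A)).
Qed.

Lemma Sigma_sub_continuous s : continuous (@Sigma_sub s).
Proof.
apply: set_type_continuous => T.
by apply: continuous_comp; [exact: val_continuous|exact: subst_biinf_continuous].
Qed.

Lemma Sigma_sh_continuous s z : continuous (@Sigma_sh s z).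
Proof.
apply: set_type_continuous => T.
by apply: continuous_comp; [exact: val_continuous|exact: shift_continuous].
Qed.

Lemma to_I01_continuous : continuous to_I01.
Proof.
by apply: set_type_continuous; apply: clamp_continuous; exact: ler01.
Qed.

(** A chart: the flow during the time from [j] to [j + 1], clamped outside. *)
Definition seg s (j : int) (x : Sigma s * R) : Omega F R s :=
  cls s (Sigma_sh j x.1, to_I01 (x.2 - j%:~R)).

Lemma seg_continuous s j : continuous (@seg s j).
Proof.
move=> x; apply: (@continuous_comp _ (Omega_pre F R s) _ _ (cls s));
  last exact: cls_continuous.
apply: pair_continuous_at.
  by apply: continuous_comp; [exact: cvg_fst|exact: Sigma_sh_continuous].
apply: continuous_comp; last exact: to_I01_continuous.
by apply: cvgB; [exact: cvg_snd|exact: cvg_cst].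
Qed.

Lemma flow_seg s j (x : Sigma s * R) :
  j%:~R <= x.2 <= j%:~R + 1 -> flow x.1 x.2 = seg j x.
Proof.
move=> xj; rewrite /seg cls_flow flow_shift /= clamp_id; last by lra.
by congr flow; lra.
Qed.

Lemma flow_continuous s : continuous (fun x : Sigma s * R => flow x.1 x.2).
Proof.
(* Times near [x.2] lie strictly between [j - 1] and [j + 1]; the two charts are pasted along time
   [j]. *)
move=> x; pose j := Num.floor x.2.
have /andP[xj1 xj2] : (j - 1)%:~R < x.2 < (j + 1)%:~R.
  by have := floor_itv x.2; rewrite -/j !intrD; lra.
have n1 : \forall z \near x, (j - 1)%:~R < z.2.
  exact: (@cvg_snd _ _ _ _ _ _ (lt_nbhsr xj1)).
have n2 : \forall z \near x, z.2 < (j + 1)%:~R.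
  exact: (@cvg_snd _ _ _ _ _ _ (lt_nbhsl xj2)).
apply: (@near_eq_continuous_at (Sigma s * R)%type _ (fun x => flow x.1 x.2)
  (fun z => if z.2 <= j%:~R then seg (j - 1) z else seg j z) x).
  apply: filterS2 n1 n2 => z; rewrite !intrD => z1 z2.
  by case: ifPn => zj; apply: flow_seg; rewrite ?intrD; lra.
apply: if_continuous => [z|||z zj]; try exact: seg_continuous.
  exact: cvg_snd.
by rewrite -!flow_seg // ?intrD; lra.
Qed.

Lemma pre_time_continuous s :
  continuous (fun z : Omega_pre F R s => \val z.2 : R).
Proof.
move=> z; apply: (@continuous_comp (Omega_pre F R s) I01 R snd \val).
  exact: cvg_snd.
exact: val_continuous.
Qed.

Lemma pre_word_continuous s :
  continuous (fun z : Omega_pre F R s => \val z.1 : biinf A).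
Proof.
move=> z; apply: (@continuous_comp (Omega_pre F R s) (Sigma s) (biinf A) fst \val).
  exact: cvg_fst.
exact: val_continuous.
Qed.

Lemma Omega_subst_continuous s : continuous (@Omega_subst A k F R s).
Proof.
apply: quot_continuous => x.
rewrite (_ : (fun y => _) = (fun y : Omega_pre F R (sshift s) => flow (Sigma_sub y.1)
   ((size (F (s 0%N) (\val y.1 0)))%:R * \val y.2))); last first.
  by apply/funext => -[T t]; exact: Omega_subst_cls.
apply: (@continuous_comp _ (Sigma s * R)%type _
  (fun y : Omega_pre F R (sshift s) => (Sigma_sub y.1,
    (size (F (s 0%N) (\val y.1 0)))%:R * \val y.2 : R))
  (fun z => flow z.1 z.2)); last exact: flow_continuous.
apply: pair_continuous_at.
  by apply: continuous_comp; [exact: cvg_fst|exact: Sigma_sub_continuous].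
apply: cvgM; last exact: pre_time_continuous.
move: x; apply: locally_constant_continuous => x.
have H : \forall y \near x, \val y.1 0 = \val x.1 0 :=
  pre_word_continuous (biinf_letter_near (\val x.1) 0).
by apply: filterS H => y /= ->.
Qed.

(** * Compactness and separation of the tiling space *)

Lemma closed_Sigma s : closed (Defs.Sigma F s).
Proof.
by move=> T clT m n; have [T' [sT' TT']] := clT _ (near_subword T m n); rewrite -TT'.
Qed.

Lemma Omega_compact s : compact [set: Omega F R s].
Proof.
apply: quot_compact; rewrite -setXTT; apply: compact_setX.
  apply: set_type_compact; apply: subclosed_compact (@biinf_compact A) _ => //.
  exact: closed_Sigma.
by apply: set_type_compact; exact: segment_compact.
Qed.

Lemma Omega_hausdorff s : hausdorff_space (Omega F R s).
Proof.
apply: (quot_hausdorff (@Rhausdorff R)) => x y inv; apply: cls_tile_nf.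
(* Candidates for invariants; [glue] gives the condition under which such a function takes equal
   values at [(T, 1)] and [(shift 1 T, 0)]. *)
have cont (h : R -> R) (g1 g2 : biinf A -> R) :
    continuous h -> continuous g1 -> continuous g2 ->
    continuous (fun z : Omega_pre F R s =>
      h (\val z.2) * g1 (\val z.1) + (1 - \val z.2) * g2 (\val z.1)).
  move=> ch c1 c2 z.
  have t_c := @pre_time_continuous s z; have T_c := @pre_word_continuous s z.
  apply: cvgD; apply: cvgM.
  - by apply: continuous_comp t_c _; exact: ch.
  - by apply: continuous_comp T_c _; exact: c1.
  - by apply: cvgB t_c; exact: cvg_cst.
  - by apply: continuous_comp T_c _; exact: c2.
have glue (h : R -> R) (g1 g2 : biinf A -> R) :
    (forall T, h 1 * g1 T = h 0 * g1 (shift 1 T) + g2 (shift 1 T)) ->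
    forall z w : Omega_pre F R s, Omega_glue z w ->
    h (\val z.2) * g1 (\val z.1) + (1 - \val z.2) * g2 (\val z.1) =
    h (\val w.2) * g1 (\val w.1) + (1 - \val w.2) * g2 (\val w.1).
  by move=> H z w [-> -> ->]; rewrite H subrr mul0r addr0 subr0 mul1r.
have cind n (a : A) :
    continuous (fun T : biinf A => if (T n : A) == a then 1 else 0 : R).
  apply: locally_constant_continuous => T.
  by apply: filterS (biinf_letter_near T n) => T' ->.
have c0 : continuous (fun T : biinf A => 0 : R).
  by move=> T; apply: cvg_cst; exact: nbhs_filter.
have c1 : continuous (fun T : biinf A => 1 : R).
  by move=> T; apply: cvg_cst; exact: nbhs_filter.
have cq : continuous (fun t : R => t * (1 - t)).
  move=> t; apply: cvgM; first exact: cvg_id.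
  by apply: cvgB; first exact: cvg_cst; exact: cvg_id.
have cq2 : continuous (fun t : R => t * (t * (1 - t))).
  by move=> t; apply: cvgM; [exact: cvg_id|exact: cq].
have invh h g1 g2 ch cg1 cg2 : (forall T, h 1 * g1 T =
      h 0 * g1 (shift 1 T) + g2 (shift 1 T)) -> _ :=
  fun H => inv _ (cont h g1 g2 ch cg1 cg2) (glue _ _ _ H).
(* The invariants are [t (1 - t)], [t^2 (1 - t)], [t (1 - t)] times the indicator of [T n = a], and
   the interpolation from the indicator of [T n = a] to that of [T (n + 1) = a]. *)
have I1 := invh _ _ _ cq c1 c0 ltac:(by move=> T /=; rewrite subrr ?mulr0 !mul0r addr0).
have I2 := invh _ _ _ cq2 c1 c0 ltac:(by move=> T /=; rewrite subrr ?mulr0 !mul0r addr0).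
have I3 n a := invh _ _ _ cq (cind n a) c0
  ltac:(by move=> T /=; rewrite subrr mulr0 !mul0r addr0).
have I4 n a := invh _ _ _ (fun t => @cvg_id _ _) (cind (n + 1) a) (cind n a)
  ltac:(by move=> T /=; rewrite mul0r mul1r add0r).
move: I1 I2 I3 I4; rewrite /tile_nf;
  case: x y {inv invh} => [[T sT] [t tI]] [[T' sT'] [t' tI']] /=.
have /andP[t0 t1] : 0 <= t <= 1 by have := set_mem tI; rewrite /= in_itv.
have /andP[t0' t1'] : 0 <= t' <= 1 by have := set_mem tI'; rewrite /= in_itv.
rewrite !mulr0 !mulr1 !addr0 => I1 I2 I3 I4.
have b01 (u : R) : u * (1 - u) = 0 -> u = 0 \/ u = 1.
  by move=> /eqP; rewrite mulf_eq0 subr_eq0 => /orP[] /eqP; [left|right; lra].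
have ind (b : bool) : (if b then 1 else 0 : R) = 1 -> b.
  by case: b => // H; have := oner_neq0 R; rewrite -H eqxx.
(* On a tile boundary [I4] determines the letters. Elsewhere [I1] and [I2] determine [t], and then
   [I3] the letters. *)
have [q0|q0] := eqVneq (t * (1 - t)) 0.
  have q0' : t' * (1 - t') = 0 by rewrite -I1.
  suff E : (if t == 1 then (shift 1 (T), 0) else (T, t)).1 =
           (if t' == 1 then (shift 1 (T'), 0) else (T', t')).1.
    by case: (b01 t q0) E => ->; case: (b01 t' q0') => ->;
      rewrite ?eqxx ?(eq_sym 0 1) ?oner_eq0 /= => ->.
  apply/funext => n; apply/esym/eqP; apply: ind; set a := _.1 n.
  have := I4 n a; rewrite /a.
  case: (b01 t q0) => ->; case: (b01 t' q0') => ->;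
    rewrite ?eqxx ?(eq_sym 0 1) ?oner_eq0 /= ?eqxx
            ?subrr ?subr0 ?mul0r ?mul1r ?add0r ?addr0 => H;
    rewrite eq_sym; exact: H.
have tt' : t = t'.
  by move: I2; rewrite -I1 => /eqP; rewrite -subr_eq0 -mulrBl mulf_eq0 (negbTE q0)
    orbF subr_eq0 => /eqP.
rewrite -tt' in I3 *.
have -> : T = T'.
  apply/funext => n; apply/esym/eqP; apply: ind.
  have := I3 n (T n); rewrite eqxx mulr1 !addr0 => /eqP.
  by rewrite eq_sym -{2}[_ * (1 - t)]mulr1 -subr_eq0 -mulrBr mulf_eq0 (negbTE q0)
    subr_eq0 => /eqP.
by case: ifP.
Qed.


(** * Surjectivity of the substitution maps *)

Lemma flow_in_range s (T : Sigma (sshift s)) (u : R) :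
  0 <= u -> exists x, Omega_subst x = flow (Sigma_sub T) u.
Proof.
move=> u0; have [n un] : exists n : nat, u <= n%:R.
  by exists (Num.bound u); exact: ltW (archi_boundP u0).
elim: n T u u0 un => [|n IH] T u u0 un.
  exists (cls (sshift s) (T, to_I01 0)); rewrite Omega_subst_cls /= clamp_id.
    by rewrite mulr0; congr flow; lra.
  by rewrite lexx ler01.
(* Inside the image of [T 0] the preimage has time [u / m]; beyond it one passes to the next tile,
   which lowers [u] by [m >= 1]. *)
have [m mE] : exists m : R, m = (size (F (s 0%N) (\val T 0)))%:R by eexists.
have m1 : 1 <= m by rewrite mE ler1n subst_letter_gt0.
case: (lerP u m) => um.
  have mu : m * (u / m) = u by rewrite mulrC divfK // gt_eqF // (lt_le_trans ltr01).
  have m0 : 0 < m by lra.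
  exists (cls (sshift s) (T, to_I01 (u / m))).
  rewrite Omega_subst_cls /= -mE clamp_id ?mu //.
  by rewrite divr_ge0 // ?ler_pdivrMr ?mul1r // ltW.
have [||x xE] := IH (Sigma_sh 1 T) (u - m).
- lra.
- by rewrite -natr1 in un; lra.
exists x; rewrite xE.
rewrite (_ : Sigma_sub (Sigma_sh 1 T) =
  Sigma_sh (size (F (s 0%N) (\val T 0))) (Sigma_sub T)).
  by rewrite flow_shift -pmulrn -mE addrC subrK.
by apply: val_inj; rewrite /= subst_biinf_shift.
Qed.

Lemma Omega_subst_surj s : mixing F (sshift s) -> growing F (sshift s) ->
  forall y : Omega F R s, exists x, Omega_subst x = y.
Proof.
move=> mix grow y; rewrite -(repK y); case: (rep y) => T t.
have key (N : nat) : exists xT : Omega F R (sshift s) * Sigma s,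
    Omega_subst xT.1 = cls s (xT.2, t) /\
    forall z, - N%:Z <= z < N%:Z -> \val xT.2 z = \val T z.
  have := set_valP T => /SigmaP /(_ (- N%:Z) (N + N)%N) [l [a]].
  rewrite iter_substS; set w := iter_subst _ _ _ _.
  have [T' sT' T'w] := Sigma_prefix l a mix grow.
  rewrite -/w /= in T'w.
  have := subword_subst_right (F (s 0%N)) T' (size w); rewrite T'w.
  set v := subst_word _ w => T'v inf.
  have [p [q vE]] : exists p q : seq A,
    v = p ++ subword (\val T) (- N%:Z) (N + N) ++ q by exact/infixP.
  pose S' : Sigma (sshift s) := exist _ T' (mem_set sT').
  have /andP[t0 t1] := I01P t.
  (* Index [size p + N] is the place of the origin of [T] in [v]. *)
  have [|x xE] := @flow_in_range s S' ((size p + N)%N%:R + \val t).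
    by rewrite addr_ge0.
  exists (x, Sigma_sh (size p + N)%N (Sigma_sub S')); split.
    by rewrite xE cls_flow flow_shift -pmulrn.
  move=> z zN /=; rewrite /shift.
  have E : subword (subst_biinf (F (s 0%N)) T') (size p) (N + N) =
           subword (\val T) (- N%:Z) (N + N).
    rewrite (@subword_nth _ _ _ _ a v (size p)).
    - by rewrite vE drop_size_cat // take_size_cat // size_subword.
    - by rewrite vE !size_cat size_subword leq_add2l leq_addr.
    - move=> i ilt; rewrite -[in RHS]T'v nth_subword.
        by congr (subst_biinf _ T' _); lia.
      by rewrite vE !size_cat size_subword -addnS leq_add2l (leq_trans ilt) ?leq_addr.
  have /subword_eqP /(_ (absz (z + N%:Z))) := E => H.
  transitivity (subst_biinf (F (s 0%N)) T' (size p + absz (z + N%:Z)%R)).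
    by congr (subst_biinf _ T' _); lia.
  by rewrite H; [congr (\val T _); lia|lia].
have [xT HxT] := choice key.
have : range (@Omega_subst A k F R s) (cls s (T, t)).
  apply: (@closed_cvg _ _ \oo _ (fun N => cls s ((xT N).2, t))).
  - apply: compact_closed_map; [exact: Omega_compact|exact: Omega_hausdorff| |].
      exact: Omega_subst_continuous.
    exact: closedT.
  - by apply: nearW => N; have [<- _] := HxT N; exists (xT N).1.
  apply: (@cvg_comp _ _ _ (fun N => ((xT N).2, t) : Omega_pre F R s) (cls s));
    last exact: cls_continuous.
  have xT2 : (fun N => (xT N).2) @ \oo --> T.
    apply: set_type_cvg; apply: prod_topology_cvg => z.
    apply/discrete_cvg; exists (absz z).+1 => // N /= zN.
    by have [_] := HxT N; apply; lia.
  exact: (@cvg_pair nat (Sigma s) I01 \oo (nbhs T) (nbhs t) _ _ _ _ (fun=> t)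
    xT2 (cvg_cst t)).
by case=> x _ xE; exists x.
Qed.

End TilingSpace.

(** * The Barge-Diamond complex *)

Section Agreement.
Context (A : finType) (f : substitution A).
Implicit Types T : biinf A.

Lemma subst_agree_right T T' M (j : nat) :
  subword T 0 M = subword T' 0 M ->
  (j < size (subst_word f (subword T 0 M)))%N ->
  subst_biinf f T j%:Z = subst_biinf f T' j%:Z.
Proof.
move=> TT' jlt; have := subword_subst_right f T' M.
rewrite -TT' -{2}(subword_subst_right f T M) => /esym/subword_eqP/(_ j jlt).
by rewrite !add0r.
Qed.

Lemma subst_agree_left T T' N (j : nat) :
  subword T (- N%:Z) N = subword T' (- N%:Z) N ->
  (0 < j <= size (subst_word f (subword T (- N%:Z) N)))%N ->
  subst_biinf f T (- j%:Z) = subst_biinf f T' (- j%:Z).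
Proof.
move=> TT' jlt; have := subword_subst_left f T' N.
rewrite -TT' -{3}(subword_subst_left f T N) => /esym/subword_eqP.
set w := size _; rewrite -/w in jlt => /(_ (w - j)%N) H.
by rewrite (_ : - j%:Z = - w%:Z + (w - j)%N%:Z) ?H //; lia.
Qed.

End Agreement.

Section BargeDiamond.
Context (R : realType) (A : finType) (k : nat) (F : 'I_k.+1 -> substitution A).
Implicit Types (s : nat -> 'I_k.+1).

Local Notation eps := (@eps A k F R).
Local Notation Sigma s := (set_type (Sigma F s)).
Local Notation I01 := (set_type `[0 : R, 1]%classic).
Local Notation ocls s := (@cls (Omega_pre F R s) (@Omega_glue A k F R s)).
Local Notation BDp s := (set_type (@BD_edges A k F R s)).
Local Notation cls s := (@cls (BDp s) (@BD_glue A k F R s)).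

Lemma eps_gt0 : 0 < eps.
Proof.
rewrite /Defs.eps; elim/big_ind: _ => [|x y x0 y0|x _].
- by rewrite invr_gt0 ltr0n.
- by rewrite lt_min x0.
- by rewrite invr_gt0 mulr_gt0 ?ltr0n ?subst_letter_gt0.
Qed.

(** If all images had length one, iterated images would not grow. So some image has length at least
    2 and [eps] is at most 1/4; the edges [inl a] are then nondegenerate. *)
Lemma eps_lt_half s (a : A) : growing F s -> 2 * eps < 1.
Proof.
move=> grow; have [i [b ib]] : exists i b, (1 < size (F i b))%N.
  apply: contrapT => H; have [L /(_ L (leqnn L) a)] := grow 2.
  suff -> : size (iter_subst F s L [:: a]) = 1%N by [].
  have sz f (w : seq A) : (exists i, f = F i) -> size (subst_word f w) = size w.
    move=> [i ->]; elim: w => // b w IH.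
    rewrite /subst_word /= size_cat -/(subst_word _ _) IH -add1n.
    congr (_ + _)%N; apply/eqP; rewrite eqn_leq subst_letter_gt0 andbT leqNgt.
    by apply/negP => ib; apply: H; exists i, b.
  elim: L s {grow} => // L IH s.
  by rewrite iter_substS sz ?IH //; exists (s 0%N).
have : eps <= (2 * (size (F i b))%:R)^-1.
  by rewrite /Defs.eps (bigD1 (i, b)) //= ge_min lexx.
have : (2 : R) <= (size (F i b))%:R by rewrite ler_nat.
move: (size (F i b))%:R => n n2 en.
have : 2 * (2 * n)^-1 < 1.
  by rewrite invfM mulrA divff ?pnatr_eq0 // mul1r invf_lt1; lra.
lra.
Qed.

Hypothesis eps_small : 2 * eps < 1.

Definition BD_pt s (x : R * discrete_topology (label A)) (h : BD_edges F s x) :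
  BD F R s := cls s (exist _ x (mem_set h)).

Lemma BD_pt_eq s x y (hx : BD_edges F s x) (hy : BD_edges F s y) :
  x = y -> BD_pt hx = BD_pt hy.
Proof. by move=> xy; congr (cls s _); exact: val_inj. Qed.

(** Picks one point in each class: vertices are moved to the edges labelled by a single letter. *)
Definition BD_nf (x : R * discrete_topology (label A)) :
    R * discrete_topology (label A) :=
  match x.2 with
  | inl a => x
  | inr (a, b) => if x.1 == - eps then (1 - eps, inl a)
                  else if x.1 == eps then (eps, inl b) else x
  end.

Lemma BD_cls_eqP s (x y : BDp s) :
  cls s x = cls s y <-> BD_nf (\val x) = BD_nf (\val y).
Proof.
have es := eps_small; have e0 := eps_gt0; split.
  apply: (@cls_inj (BDp s) (@BD_glue A k F R s) _
    (fun x => BD_nf (\val x))) => {}x {}y.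
  move=> [[a [b [-> ->]]]|[a [b [-> ->]]]]; rewrite /BD_nf /= eqxx //.
  by rewrite (@gt_eqF _ R) // gtrN.
have e1 : eps <= 1 - eps by lra.
suff H (z : BDp s) : exists h : BD_edges F s (BD_nf (\val z)), cls s z = BD_pt h.
  by have [hx ->] := H x; have [hy ->] := H y; exact: BD_pt_eq.
case: z => -[r [a|[a b]]] h; rewrite /BD_nf /=.
  by exists (set_mem h); congr (cls s _); exact: val_inj.
case: eqP => [rE|_].
  have h' : BD_edges F s (1 - eps, inl a) by rewrite /BD_edges /= e1 lexx.
  by exists h'; apply/esym/cls_eq; left; exists a, b; rewrite /= rE.
case: eqP => [rE|_].
  have h' : BD_edges F s (eps, inl b) by rewrite /BD_edges /= e1 lexx.
  by exists h'; apply/esym/cls_eq; right; exists b, a; rewrite /= rE.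
by exists (set_mem h); congr (cls s _); exact: val_inj.
Qed.

Lemma BD_nf_coord (T : biinf A) (t : R) : 0 <= t < 1 ->
  BD_nf (BD_coord F T t) =
  if t < eps then (t, inr (T (-1), T 0))
  else if t <= 1 - eps then (t, inl (T 0)) else (t - 1, inr (T 0, T 1)).
Proof.
move=> t01; have es := eps_small; have e0 := eps_gt0; rewrite /BD_coord /BD_nf.
case: (ltgtP t eps) => te /=.
- rewrite ifF; last by apply/eqP; lra.
  by rewrite ifF //; apply/eqP; lra.
- case: ifP => //= te'; rewrite ifF; last by apply/eqP; lra.
  by rewrite ifF //; apply/eqP; lra.
- rewrite te eqxx ifF; last by apply/eqP; lra.
  by rewrite ifT //; lra.
Qed.

(* What a point of the complex remembers of a tiling. *)
Definition same_view (T T' : biinf A) (t : R) :=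
  [/\ T 0 = T' 0, t < eps -> T (-1) = T' (-1) & 1 - eps < t -> T 1 = T' 1].

(** The inequalities in [same_view] are strict because at [t = eps] and [t = 1 - eps] the projection
    is a vertex, shared by edges with different neighbours. *)
Lemma BD_proj_eqP s (x y : Omega F R s) :
  BD_proj x = BD_proj y <->
  (Omega_nf x).2 = (Omega_nf y).2 /\
  same_view (Omega_nf x).1 (Omega_nf y).1 (Omega_nf x).2.
Proof.
have es := eps_small; have e0 := eps_gt0.
have [_ ix] := Omega_nfP x; have [_ iy] := Omega_nfP y.
apply: (iff_trans (BD_cls_eqP _ _)); rewrite /= !BD_nf_coord //.
case: (Omega_nf x) (Omega_nf y) ix iy => [T t] [T' t'] /= ix iy.
rewrite /same_view; split.
  case: (ltP t eps) => te; case: (ltP t' eps) => te'.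
  - by move=> [-> -> ->]; split=> //; split=> // ?; exfalso; lra.
  - by case: ifP => // _ [? ? ?]; exfalso; lra.
  - by case: ifP => // _ [? ? ?]; exfalso; lra.
  case: (lerP t (1 - eps)) => te2; case: (lerP t' (1 - eps)) => te2' //.
  - by move=> [-> ->]; split=> //; split=> // ?; exfalso; lra.
  - by move=> [tt' -> ->]; split; [lra|split=> // ?; exfalso; lra].
move=> [<- [-> V1 V2]]; case: ltP => te; first by rewrite V1.
by case: lerP => // te2; rewrite V2.
Qed.

(** This makes the induced map well defined. Substitution does not decrease the distances from the
    origin to the ends of its supertile, so a neighbour outside the image of [T 0] is seen only if
    the neighbour of [T 0] was. *)
Lemma BD_proj_subst s (x y : Omega F R (sshift s)) :
  BD_proj x = BD_proj y ->
  BD_proj (Omega_subst x) = BD_proj (Omega_subst y).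
Proof.
have es := eps_small; have e0 := eps_gt0.
move=> /BD_proj_eqP[tt' [T0 Tl Tr]]; apply/BD_proj_eqP; rewrite !Omega_nf_subst.
have [_ /=] := Omega_nfP x; move: tt' T0 Tl Tr.
case: (Omega_nf x) (Omega_nf y) => [T t] [T' _] /= <- T0 Tl Tr t01.
rewrite -T0; split => //; set f := F (s 0%N).
have [n nE] : exists n, n = size (f (T 0)) by eexists.
have n1 : (0 < n)%N by rewrite nE subst_letter_gt0.
have n1R : 1 <= n%:R :> R by rewrite ler1n.
rewrite -nE; have nt0 : 0 <= n%:R * t by rewrite mulr_ge0 //; lra.
have ntn : n%:R * t < n%:R by rewrite gtr_pMr; lra.
have nt1 : t <= n%:R * t by rewrite ler_peMl //; lra.
have nt2 : 1 - t <= n%:R * (1 - t) by rewrite ler_peMl //; lra.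
rewrite mulrBr mulr1 in nt2.
have [p pE] : exists p : nat, Num.floor (n%:R * t) = p.
  by case E : (Num.floor _) => [p|p]; [exists p|have : 0 <= Num.floor (n%:R * t);
    [rewrite floor_ge_int|rewrite E]].
have pn : (p < n)%N.
  have := floor_le (n%:R * t); rewrite pE -pmulrn => /le_lt_trans/(_ ntn).
  by rewrite ltr_nat.
rewrite pE -pmulrn /same_view /shift.
have letter i : (i < n)%N -> subst_biinf f T i%:Z = subst_biinf f T' i%:Z.
  by rewrite nE => ilt; rewrite !subst_biinf_letter -?T0.
split; first by rewrite !add0r; exact: letter.
(* For [p > 0] the left neighbour is in the image of [T 0]; for [p = 0] it is the last letter of the
   image of [T (-1)]. *)
- case: p pE pn => [|p] pE pn; last first.
    move=> _; rewrite intS addKr.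
    by apply: letter; exact: ltnW.
  rewrite subr0 => te; apply: (@subst_agree_left _ _ _ _ 1 1).
    by rewrite !subword1 Tl //; lra.
  by rewrite subword1 subst_word1 subst_letter_gt0.
rewrite -intS.
move=> te; have [pn1|pn1] := ltnP p.+1 n; first exact: letter.
(* The origin is in the last tile of the image of [T 0], and the right neighbour is the first letter
   of the image of [T 1]. *)
have np : n = p.+1 by apply/eqP; rewrite eqn_leq pn1.
apply: (@subst_agree_right _ _ _ _ 2).
  have E2 (U : biinf A) : subword U 0 2 = [:: U 0 : A; U 1 : A] by [].
  by rewrite !E2 -T0 Tr //; move: te; rewrite np -natr1 in nt2 *; lra.
rewrite -np nE -[subword T 0 2]/([:: T 0 : A] ++ [:: T 1 : A]) subst_word_cat.
by rewrite size_cat !subst_word1 -[X in (X < _)%N]addn0 ltn_add2l subst_letter_gt0.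
Qed.


(** * Separation of points of the complex *)

Definition edge_start (l : label A) : R := if l is inl _ then eps else - eps.
Definition edge_end (l : label A) : R := if l is inl _ then 1 - eps else eps.

Lemma edge_function_continuous s (h : label A -> R -> R) :
  (forall l, continuous (h l)) ->
  continuous (fun x : BDp s => h (\val x).2 (\val x).1).
Proof.
move=> ch x.
apply: (@near_eq_continuous_at (BDp s) R _ (fun z => h (\val x).2 (\val z).1)).
  have cv : continuous (fun z : BDp s => (\val z).2 : discrete_topology (label A)).
    move=> z; apply: (@continuous_comp (BDp s) (R * discrete_topology (label A))%type
      (discrete_topology (label A)) \val snd); first exact: val_continuous.
    exact: cvg_snd.
  have H := @discrete_locally_constant (BDp s) (label A) _ cv x.
  by apply: filterS H => z zx; congr (h _ _); exact: zx.
apply: (@continuous_comp (BDp s) R R (fun z => (\val z).1) (h (\val x).2));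
  last exact: ch.
apply: (@continuous_comp (BDp s) (R * discrete_topology (label A))%type R \val fst).
  exact: val_continuous.
exact: cvg_fst.
Qed.

Lemma affine_continuous (p q : R) : continuous (fun r : R => p * r + q).
Proof.
move=> r; apply: cvgD; last exact: cvg_cst.
by apply: cvgM; [exact: cvg_cst|exact: cvg_id].
Qed.

Lemma BD_hausdorff s : hausdorff_space (BD F R s).
Proof.
have es := eps_small; have e0 := eps_gt0.
apply: (quot_hausdorff (@Rhausdorff R)) => x y inv.
have {}inv (h : label A -> R -> R) : (forall l, continuous (h l)) ->
    (forall a b, h (inl a) (1 - eps) = h (inr (a, b)) (- eps)) ->
    (forall a b, h (inl a) eps = h (inr (b, a)) eps) ->
    h (\val x).2 (\val x).1 = h (\val y).2 (\val y).1.
  move=> ch h1 h2.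
  apply: (inv _ (edge_function_continuous ch)) => z w.
  by move=> [[a [b [-> ->]]]|[a [b [-> ->]]]] /=.
apply/BD_cls_eqP.
case: x y inv => -[r l] xe [[r' l'] ye] /= inv.
(* [w] vanishes exactly at the ends of an edge. Extended by zero to the other edges, [w] and its
   product with [r] determine the edge and the parameter of an interior point. *)
pose w (l : label A) (r : R) := (r - edge_start l) * (edge_end l - r).
have w1 l0 : w l0 (edge_start l0) = 0 by rewrite /w subrr mul0r.
have w2 l0 : w l0 (edge_end l0) = 0 by rewrite /w subrr mulr0.
have cw l0 : continuous (w l0).
  move=> u; apply: cvgM.
    by apply: cvgB; [exact: cvg_id|exact: cvg_cst].
  by apply: cvgB; [exact: cvg_cst|exact: cvg_id].
have c0 : continuous (fun r : R => 0 : R).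
  by move=> u; apply: cvg_cst; exact: nbhs_filter.
have U l0 : (if l == l0 then w l r else 0) = (if l' == l0 then w l' r' else 0).
  apply: (inv (fun l r => if l == l0 then w l r else 0)).
  - by move=> l1; case: (l1 == l0).
  - by move=> a b; rewrite (w2 (inl a)) (w1 (inr (a, b))); do 2 case: ifP.
  - by move=> a b; rewrite (w1 (inl a)) (w2 (inr (b, a))); do 2 case: ifP.
have V l0 : (if l == l0 then r * w l r else 0) =
            (if l' == l0 then r' * w l' r' else 0).
  apply: (inv (fun l r => if l == l0 then r * w l r else 0)).
  - by move=> l1; case: (l1 == l0) => // u; apply: cvgM; [exact: cvg_id|exact: cw].
  - by move=> a b; rewrite (w2 (inl a)) (w1 (inr (a, b))) !mulr0; do 2 case: ifP.
  - by move=> a b; rewrite (w1 (inl a)) (w2 (inr (b, a))) !mulr0; do 2 case: ifP.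
have interior : w l r != 0 -> (r, l) = (r', l').
  move=> wn0; have := U l; have := V l; rewrite eqxx; case: eqP => [->|_].
    move=> + E; rewrite E => /(mulIf _) -> //.
    by rewrite -E.
  by move=> _ w0; rewrite w0 eqxx in wn0.
have interior' : w l' r' != 0 -> (r, l) = (r', l').
  move=> wn0; have := U l'; have := V l'; rewrite eqxx; case: eqP => [->|_].
    move=> + E; rewrite -E => /(mulIf _) -> //.
    by rewrite E.
  by move=> _ w0; rewrite -w0 eqxx in wn0.
have [w0|/interior -> //] := eqVneq (w l r) 0.
have [w0'|/interior' -> //] := eqVneq (w l' r') 0.
(* Tent functions: [outf a] peaks at the end of the edge [inl a], [inf a] at its start, and each
   vanishes at all other vertices. The slopes are scaled to give the peak [2 * eps * (1 - 2 * eps)]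
   on both kinds of edges. *)
pose outf a (l : label A) (r : R) := match l with
  | inl b => if b == a then 2 * eps * r - 2 * eps * eps else 0
  | inr (b, _) => if b == a then (2 * eps - 1) * r + eps * (1 - 2 * eps) else 0
  end.
pose inf a (l : label A) (r : R) := match l with
  | inl b => if b == a then - (2 * eps) * r + 2 * eps * (1 - eps) else 0
  | inr (_, b) => if b == a then (1 - 2 * eps) * r + eps * (1 - 2 * eps) else 0
  end.
have O a : outf a l r = outf a l' r'.
  apply: inv => [[b|[b c]]|b c|b c]; rewrite /outf /=.
  - by case: (b == a) => //; exact: affine_continuous.
  - by case: (b == a) => //; exact: affine_continuous.
  - by case: ifP => // _; lra.
  - by case: ifP => // _; case: ifP => // _; lra.
have I a : inf a l r = inf a l' r'.
  apply: inv => [[b|[b c]]|b c|b c]; rewrite /inf /=.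
  - by case: (b == a) => //; exact: affine_continuous.
  - by case: (c == a) => //; exact: affine_continuous.
  - by case: ifP => // _; case: ifP => // _; lra.
  - by case: ifP => // _; lra.
have vertex l0 r0 : w l0 r0 = 0 -> exists a,
    (BD_nf (r0, l0) = (eps, inl a) /\ forall b, outf b l0 r0 = 0 /\
       inf b l0 r0 = if a == b then 2 * eps * (1 - 2 * eps) else 0) \/
    (BD_nf (r0, l0) = (1 - eps, inl a) /\ forall b, inf b l0 r0 = 0 /\
       outf b l0 r0 = if a == b then 2 * eps * (1 - 2 * eps) else 0).
  rewrite /w /outf /inf /BD_nf /edge_start /edge_end => /eqP.
  rewrite mulf_eq0 !subr_eq0.
  case: l0 => [a|[a b]] /orP[] /eqP E /=.
  - by exists a; left; rewrite E; split=> // b; case: ifP => _; split=> //; lra.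
  - by exists a; right; rewrite -E; split=> // b; case: ifP => _; split=> //; lra.
  - exists a; right; rewrite E eqxx; split=> // c.
    by split; case: ifP => // _; lra.
  - exists b; left; rewrite -E eqxx (@gt_eqF _ R) ?gtrN //; split=> // c.
    by split; case: ifP => // _; lra.
have c1 : 2 * eps * (1 - 2 * eps) <> 0.
  by apply/eqP; rewrite mulf_neq0 // gt_eqF //; lra.
have [a [[-> Ha]|[-> Ha]]] := vertex _ _ w0;
  have [b [[-> Hb]|[-> Hb]]] := vertex _ _ w0'.
- have [_] := Ha a; rewrite I; have [_ ->] := Hb a; rewrite eqxx.
  by case: eqP => [->|_ /esym/c1].
- by have [_] := Ha a; rewrite I eqxx; have [-> _] := Hb a => /esym/c1.
- by have [_] := Ha a; rewrite O eqxx; have [-> _] := Hb a => /esym/c1.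
- have [_] := Ha a; rewrite O; have [_ ->] := Hb a; rewrite eqxx.
  by case: eqP => [->|_ /esym/c1].
Qed.

(** * The projection is a continuous surjection *)

Lemma BD_edges_clamp (l : label A) (t : R) s (T : Sigma s) (m : int) :
  (if l is inr ab then ab = (\val T m : A, \val T (m + 1) : A) else True) ->
  BD_edges F s (clamp (edge_start l) (edge_end l) t, l).
Proof.
have es := eps_small; have e0 := eps_gt0.
case: l => [a _|ab abE]; rewrite /BD_edges /=; first by apply: clamp_itv; lra.
split; last by apply: clamp_itv; lra.
by exists (\val T); [exact: set_valP|exists m].
Qed.

(** The first of the three pieces of the projection, each extended to all of [Omega_pre] by clamping
    so that the pieces can be pasted. *)
Definition view_left s (z : Omega_pre F R s) : BDp s := exist _
  (clamp (- eps) eps (\val z.2), inr (\val z.1 (-1) : A, \val z.1 0 : A))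
  (mem_set (@BD_edges_clamp (inr (\val z.1 (-1) : A, \val z.1 0 : A)) (\val z.2)
     s z.1 (-1) erefl)).

Definition view_mid s (z : Omega_pre F R s) : BDp s := exist _
  (clamp eps (1 - eps) (\val z.2), inl (\val z.1 0 : A))
  (mem_set (@BD_edges_clamp (inl (\val z.1 0 : A)) (\val z.2) s z.1 0 I)).

Definition view_right s (z : Omega_pre F R s) : BDp s := exist _
  (clamp (- eps) eps (\val z.2 - 1), inr (\val z.1 0 : A, \val z.1 1 : A))
  (mem_set (@BD_edges_clamp (inr (\val z.1 0 : A, \val z.1 1 : A)) (\val z.2 - 1)
     s z.1 0 erefl)).

Lemma view_continuous s (h : Omega_pre F R s -> BDp s) (g : R -> R)
    (l : biinf A -> label A) :
  (forall z, \val (h z) = (g (\val z.2), l (\val z.1))) -> continuous g ->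
  (forall T : biinf A, \forall T' \near T, l T' = l T) ->
  continuous (fun z => cls s (h z)).
Proof.
move=> hE cg cl z.
apply: (@continuous_comp (Omega_pre F R s) (BDp s) (BD F R s) h (cls s));
  last exact: cls_continuous.
apply: set_type_continuous => {}z.
rewrite (_ : (fun z => \val (h z)) =
    (fun z => (g (\val z.2), l (\val z.1)) : R * discrete_topology (label A)));
  last by apply/funext.
apply: pair_continuous_at.
  apply: (@continuous_comp (Omega_pre F R s) R R (fun z => \val z.2) g).
    exact: pre_time_continuous.
  exact: cg.
move: z; apply: locally_constant_continuous => z.
have H : \forall y \near z, l (\val y.1) = l (\val z.1) :=
  pre_word_continuous (cl (\val z.1)).
exact: H.
Qed.

Lemma letter_pair_near (T : biinf A) m n (g : A -> A -> label A) :
  \forall T' \near T, g (T' m) (T' n) = g (T m) (T n).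
Proof.
by apply: filterS2 (biinf_letter_near T m) (biinf_letter_near T n) => T' -> ->.
Qed.

Lemma view_left_mid s (z : Omega_pre F R s) : \val z.2 = eps ->
  cls s (view_left z) = cls s (view_mid z).
Proof.
have es := eps_small; have e0 := eps_gt0 => ze.
apply/esym/cls_eq; right; exists (\val z.1 0), (\val z.1 (-1)).
by split; rewrite /= ze clamp_id //; lra.
Qed.

Lemma view_mid_right s (z : Omega_pre F R s) : \val z.2 = 1 - eps ->
  cls s (view_mid z) = cls s (view_right z).
Proof.
have es := eps_small; have e0 := eps_gt0 => ze.
apply/cls_eq; left; exists (\val z.1 0), (\val z.1 1).
by split; rewrite /= ze clamp_id //; [lra|congr (_, _); lra|lra].
Qed.

(** At [t = 1] the right view is the view from the next tile at time 0, so the formula respects the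
    gluing. *)
Lemma BD_proj_cls s (z : Omega_pre F R s) :
  BD_proj (ocls s z) = if \val z.2 <= eps then cls s (view_left z)
    else if \val z.2 <= 1 - eps then cls s (view_mid z)
    else cls s (view_right z).
Proof.
have es := eps_small; have e0 := eps_gt0.
rewrite -!(fun_if (fun z => cls s z)); congr (cls s _); apply: val_inj.
rewrite !(fun_if \val) /= Omega_nf_cls /tile_nf; case: z => -[T sT] [t tI] /=.
have /andP[t0 t1] : 0 <= t <= 1 by have := set_mem tI; rewrite /= in_itv.
case: (eqVneq t 1) => [tE|tn1] /=.
  rewrite tE.
  have e1 : (1 <= eps) = false by apply/negbTE; rewrite -ltNge; lra.
  have e2 : (1 <= 1 - eps) = false by apply/negbTE; rewrite -ltNge; lra.
  by rewrite /BD_coord e1 e2 ltW //= subrr clamp_id //; lra.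
rewrite /BD_coord; case: (lerP t eps) => h /=; first by rewrite clamp_id //; lra.
by case: (lerP t (1 - eps)) => h' /=; rewrite clamp_id //; lra.
Qed.

Lemma BD_proj_continuous s : continuous (@BD_proj A k F R s).
Proof.
have es := eps_small; have e0 := eps_gt0.
apply: quot_continuous.
rewrite (_ : (fun x => _) = (fun z : Omega_pre F R s =>
    if \val z.2 <= eps then cls s (view_left z)
    else if \val z.2 <= 1 - eps then cls s (view_mid z)
    else cls s (view_right z))); last by apply/funext => z; exact: BD_proj_cls.
have t_c := @pre_time_continuous R A k F s.
apply: if_continuous => // [||z zE].
- apply: (@view_continuous s _ (clamp (- eps) eps)
    (fun T => inr (T (-1) : A, T 0 : A))) => //.
    by apply: clamp_continuous; lra.
  by move=> T; apply: (letter_pair_near T (-1) 0 (fun a b => inr (a, b))).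
- apply: if_continuous => // [||z].
  + apply: (@view_continuous s _ (clamp eps (1 - eps)) (fun T => inl (T 0 : A))) => //.
      by apply: clamp_continuous; lra.
    by move=> T; apply: (letter_pair_near T 0 0 (fun a b => inl a)).
  + apply: (@view_continuous s _ (fun t => clamp (- eps) eps (t - 1))
      (fun T => inr (T 0 : A, T 1 : A))) => //.
      move=> t; apply: (@continuous_comp R R R (fun t => t - 1) (clamp (- eps) eps)).
        by apply: cvgB; [exact: cvg_id|exact: cvg_cst].
      by apply: clamp_continuous; lra.
    by move=> T; apply: (letter_pair_near T 0 1 (fun a b => inr (a, b))).
  + exact: view_mid_right.
- by rewrite ifT ?view_left_mid // zE; lra.
Qed.

(** A point of [inl a] comes from a sequence with [a] at the origin; a point of [inr (a, b)] from an
    occurrence of the two letters, put at positions -1 and 0 if [0 <= r] and at 0 and 1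
    otherwise. *)
Lemma BD_proj_surj s : mixing F s -> growing F s ->
  forall y : BD F R s, exists x, BD_proj x = y.
Proof.
have es := eps_small; have e0 := eps_gt0.
move=> mix grow y; rewrite -(repK y); case: (rep y) => -[r [a|[a b]]] xe.
  have /andP[r1 r2] : eps <= r <= 1 - eps := set_mem xe.
  have [T sT] := Sigma_prefix 0 a mix grow; rewrite /iter_subst /= subword1 => -[Ta].
  exists (ocls s (exist _ T (mem_set sT), to_I01 r)); rewrite BD_proj_cls /=.
  rewrite clamp_id; last by lra.
  have -> : cls s (exist _ (r, inl a) xe) =
      cls s (view_mid (exist _ T (mem_set sT), to_I01 r)).
    congr (cls s _); apply: val_inj => /=.
    by rewrite !clamp_id ?Ta //; lra.
  case: ifP => [h|h]; last by rewrite ifT.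
  by apply: view_left_mid; rewrite /= clamp_id; lra.
have [[T sT [m []]]] := set_mem xe.
rewrite [X in X -> _]/= => Ta Tb /= /andP[r1 r2].
have [r0|r0] := lerP 0 r.
  exists (ocls s (Sigma_sh (m + 1) (exist _ T (mem_set sT)), to_I01 r)).
  rewrite BD_proj_cls /= clamp_id; last by lra.
  rewrite r2; congr (cls s _); apply: val_inj => /=.
  rewrite (clamp_id (a := 0)); last by lra.
  rewrite clamp_id; last by lra.
  by rewrite /shift -Ta -Tb; congr (_, inr (T _, T _)); lia.
exists (ocls s (Sigma_sh m (exist _ T (mem_set sT)), to_I01 (r + 1))).
have -> : cls s (exist _ (r, inr (a, b)) xe) =
    cls s (view_right (Sigma_sh m (exist _ T (mem_set sT)), to_I01 (r + 1))).
  congr (cls s _); apply: val_inj => /=.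
  rewrite (clamp_id (a := 0)); last by lra.
  rewrite clamp_id; last by lra.
  rewrite /shift -Ta -Tb addrK add0r; congr (_, inr (T _, T _)); lia.
rewrite BD_proj_cls /= clamp_id; last by lra.
rewrite ifF; last by apply/negbTE; rewrite -ltNge; lra.
case: ifP => // h; apply: view_mid_right; rewrite /= clamp_id; lra.
Qed.

End BargeDiamond.

(** * Inverse limits *)

Section InverseLimit.
Context (X Y : nat -> topologicalType).
Context (phi : forall i, X i.+1 -> X i) (psi : forall i, X i -> X i.+1).
Context (p : forall i, X i -> Y i) (f : forall i, Y i.+1 -> Y i).

Fixpoint lift_tower i : X 0%N -> X i :=
  if i is j.+1 then fun x => psi (lift_tower j x) else id.

Hypothesis psiK : forall i, cancel (@psi i) (@phi i).
Hypothesis phiK : forall i, cancel (@phi i) (@psi i).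
Hypothesis fp : forall i x, f (p x) = p (phi x) :> Y i.
Hypothesis p_surj : forall i (y : Y i), exists x, p x = y.
Hypothesis X_compact : compact [set: X 0%N].
Hypothesis Y_hausdorff : forall i, hausdorff_space (Y i).
Hypothesis psi_continuous : forall i, continuous (@psi i).
Hypothesis p_continuous : forall i, continuous (@p i).
Hypothesis p_separates : forall x x' : X 0%N,
  (forall i, p (lift_tower i x) = p (lift_tower i x')) -> x = x'.

Lemma lift_tower_surj i (z : X i) : exists x, lift_tower i x = z.
Proof.
elim: i z => [|i IH] z; first by exists z.
by have [x /= xE] := IH (phi z); exists x; rewrite /= xE phiK.
Qed.

Lemma lift_tower_continuous i : continuous (lift_tower i).
Proof.
elim: i => [|i IH] x; first exact: cvg_id.
by apply: (@continuous_comp _ _ _ (lift_tower i)); [exact: IH|exact: psi_continuous].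
Qed.

Lemma tower_coordP x i : f (p (lift_tower i.+1 x)) = p (lift_tower i x).
Proof. by rewrite fp /= psiK. Qed.

Definition to_invlim (x : X 0%N) : invlim f :=
  exist _ (fun i => p (lift_tower i x)) (mem_set (tower_coordP x)).

Lemma invlim_coord_continuous i :
  continuous (fun y : invlim f => (\val y : prod_topology Y) i).
Proof.
move=> y; apply: (@continuous_comp (invlim f) (prod_topology Y) (Y i) \val (@proj _ _ i)).
  exact: val_continuous.
exact: proj_continuous.
Qed.

Lemma invlim_hausdorff : hausdorff_space (invlim f).
Proof.
apply: hausdorff_separated => y y' yy'; apply: contrapT => sep.
apply: yy'; apply: val_inj; apply: functional_extensionality_dep => i.
apply: contrapT => ne; apply: sep; exists (Y i) => //.
by exists (fun y : invlim f => (\val y : prod_topology Y) i);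
  first exact: invlim_coord_continuous.
Qed.

Lemma to_invlim_continuous : continuous to_invlim.
Proof.
apply: set_type_continuous; apply: prod_topology_continuous => i x.
apply: (@continuous_comp _ _ _ (lift_tower i)); last exact: p_continuous.
exact: lift_tower_continuous.
Qed.

Lemma to_invlim_surj (y : invlim f) : exists x, to_invlim x = y.
Proof.
have fy i : f (\val y i.+1) = \val y i by exact: (set_valP y).
(* Lift the coordinate at level [N] and follow it down to level 0; it determines the coordinates
   below. *)
have key N : exists x, forall j, (j <= N)%N -> p (lift_tower j x) = \val y j.
  have [z zE] := p_surj (\val y N); have [x xE] := lift_tower_surj z.
  exists x => j jN; rewrite -(subKn jN); elim: (N - j)%N (leq_subr j N) => [|d IH] dN.
    by rewrite subn0 xE.
  have E : (N - d = (N - d.+1).+1)%N by rewrite subnSK.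
  by rewrite -tower_coordP -fy; congr f; rewrite -E; apply: IH; exact: ltnW.
have [x Hx] := choice key.
have [j||z Hz] := @compact_nested_closed _ x
  (fun j => [set x | p (lift_tower j x) = \val y j]) X_compact.
- have cl : closed [set \val y j].
    exact: accessible_closed_set1 (hausdorff_accessible (@Y_hausdorff j)) _.
  have : continuous (fun x => p (lift_tower j x)).
    move=> z; apply: (@continuous_comp _ _ _ (lift_tower j)); last exact: p_continuous.
    exact: lift_tower_continuous.
  by move/continuous_closedP => /(_ _ cl).
- by move=> j i ji; exact: Hx.
- by exists z; apply: val_inj; apply: functional_extensionality_dep => i; exact: Hz.
Qed.

(** [to_invlim] is a continuous bijection from a compact space to a Hausdorff space. *)
Lemma homeomorphic_invlim : homeomorphic (X 0%N) (invlim f).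
Proof.
have [g gK] := choice to_invlim_surj.
have Kg : cancel to_invlim g.
  move=> x; apply: p_separates => i.
  by have /(congr1 (fun y => \val y i)) := gK (to_invlim x).
exists to_invlim, g; split => //; first exact: to_invlim_continuous.
apply: compact_bij_continuous (to_invlim_continuous) Kg gK => //.
exact: invlim_hausdorff.
Qed.

End InverseLimit.

(** * Towers of tilings with the same views *)

Section Border.
Context (R : realType) (A : finType) (k : nat) (F : 'I_k.+1 -> substitution A).
Implicit Types (s : nat -> 'I_k.+1).

(** Along such a chain the image of [c L] under the first [L] substitutions is a single letter, for
    every [L]. *)
Lemma growing_not_singles s (c : nat -> A) : growing F s ->
  ~ (forall j, F (s j) (c j.+1) = [:: c j] :> seq A).
Proof.
move=> /(_ 2)[L /(_ L (leqnn L) (c L))] + Hc.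
suff -> : iter_subst F s L [:: c L] = [:: c 0%N] by [].
elim: L s c Hc => // L IH s c Hc.
rewrite iter_substS (IH (sshift s) (fun j => c j.+1)) => [|j]; last exact: Hc.
by rewrite subst_word1 Hc.
Qed.

(* [p i] is the distance at level [i] from the origin to the first
   disagreement of two tilings on one side, [e i] and [r i] are the distances
   of the origin to the end of its supertile and of its tile on that side. *)
Lemma bounded_disagreement s (p e : nat -> nat) (r : nat -> R) (a c : nat -> A) :
  growing F s ->
  (forall i, p i.+1 + e i <= p i)%N ->
  (forall i, p i = p i.+1 -> (1 < p i)%N -> F (s i) (c i.+1) = [:: c i] :> seq A) ->
  (forall i, e i = 0%N -> r i = (size (F (s i) (a i.+1)))%:R * r i.+1 /\
     (size (F (s i) (a i.+1)) = 1%N -> F (s i) (a i.+1) = [:: a i] :> seq A)) ->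
  (forall i, 0 < p i)%N ->
  (forall i, p i = 1%N -> eps F R <= r i) -> (forall i, r i <= 1) -> False.
Proof.
move=> grow pe single zoom p0 far r1.
have e0 := @eps_gt0 R A k F.
have pmono i j : (i <= j)%N -> (p j <= p i)%N.
  move=> /subnKC <-; elim: (j - i)%N => [|d IH]; first by rewrite addn0.
  by rewrite addnS; have := pe (i + d)%N; lia.
(* [p] reaches its minimum at [I] and stays there, so [e] vanishes from then on. *)
have [I pI] : exists I, forall i, (I <= i)%N -> p i = p I.
  have ex : exists v, `[< exists i, p i = v >] by exists (p 0%N); apply/asboolP; exists 0%N.
  case: (ex_minnP ex) => v /asboolP[I IE] vmin; exists I => i Ii.
  apply/eqP; rewrite eqn_leq pmono //= IE vmin //.
  by apply/asboolP; exists i.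
have eI i : (I <= i)%N -> e i = 0%N.
  by move=> Ii; have := pe i; rewrite !pI ?(leqW Ii) //; lia.
have growI J := growing_iter J grow.
(* A stable value above 1 gives a chain of letters with images of length one. *)
have [pI1|pI1] := ltnP 1 (p I).
  apply: (growing_not_singles (c := fun j => c (I + j)%N) (growI I)) => j.
  rewrite iter_sshiftE addnS; apply: single; rewrite !pI //; lia.
have farI i : (I <= i)%N -> eps F R <= r i.
  by move=> Ii; apply: far; rewrite pI //; have := p0 I; lia.
have step i : (I <= i)%N -> r i.+1 <= r i.
  move=> Ii; have [-> _] := zoom i (eI i Ii).
  by rewrite ler_peMl ?ler1n ?subst_letter_gt0 // (le_trans _ (farI _ (leqW Ii))) // ltW.
have rmono i j : (I <= i <= j)%N -> r j <= r i.
  move=> /andP[Ii /subnKC <-]; elim: (j - i)%N => [|d IH]; first by rewrite addn0.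
  by rewrite addnS (le_trans (step _ _) IH) // (leq_trans Ii) // leq_addr.
(* Each level divides [r] by the length of an image, and by growth lengths above 1 recur. As [r]
   never falls below [eps], it must be at least [2 ^ K * eps] at level [J] for every [K], against
   the bound 1. *)
have double K : forall J, (I <= J)%N -> (2 ^ K)%N%:R * eps F R <= r J.
  elim: K => [|K IH] J IJ; first by rewrite expn0 mul1r farI.
  have [j Jj nj] : exists2 j, (J <= j)%N & (1 < size (F (s j) (a j.+1)))%N.
    apply: contrapT => H.
    apply: (growing_not_singles (c := fun j => a (J + j)%N) (growI J)) => j.
    rewrite iter_sshiftE addnS; have [|_] := zoom (J + j)%N.
      by apply: eI; rewrite (leq_trans IJ) // leq_addr.
    apply; apply/eqP; rewrite eqn_leq subst_letter_gt0 andbT leqNgt.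
    by apply/negP => nj; apply: H; exists (J + j)%N => //; exact: leq_addr.
  have Ij := leq_trans IJ Jj.
  rewrite (le_trans _ (rmono J j _)) ?IJ //.
  have [-> _] := zoom j (eI j Ij).
  rewrite expnS natrM -mulrA ler_pM ?ler_nat //.
    by rewrite mulr_ge0 // ltW.
  by apply: IH; exact: leqW.
pose K := Num.bound (eps F R)^-1.
have KE : (eps F R)^-1 < K%:R by apply: archi_boundP; rewrite invr_ge0 ltW.
have : K%:R * eps F R <= 1.
  apply: le_trans (r1 I); apply: le_trans (double K I (leqnn I)).
  by rewrite ler_pM2r // ler_nat ltnW // ltn_expl.
by rewrite -ler_pdivlMr // div1r leNgt KE.
Qed.

Section Tower.
Context (T T' : nat -> biinf A) (t : nat -> R) (s : nat -> 'I_k.+1).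
Local Notation n i := (size (F (s i) (T i.+1 0))).
Hypothesis grow : growing F s.
Hypothesis t01 : forall i, 0 <= t i < 1.
Hypothesis view : forall i, same_view F (T i) (T' i) (t i).
Hypothesis tower : forall i, exists m : nat, [/\ (m < n i)%N,
  T i = shift m (subst_biinf (F (s i)) (T i.+1)),
  T' i = shift m (subst_biinf (F (s i)) (T' i.+1)) &
  t i = (n i)%:R * t i.+1 - m%:R].

Let letter0 i : T i 0 = T' i 0. Proof. by have [] := view i. Qed.

Let letter_eq i j : (j < n i)%N ->
  subst_biinf (F (s i)) (T i.+1) j%:Z = subst_biinf (F (s i)) (T' i.+1) j%:Z.
Proof. by move=> ji; rewrite !subst_biinf_letter -?letter0. Qed.

(** [bounded_disagreement] applies with [p i] the distance to the first disagreement on the left,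
    [m i] the number of tiles left of the origin's tile in its supertile, and [t i] the distance to
    the left end of the tile. *)
Lemma tower_agree_left : forall j : nat, T 0%N (- j%:Z) = T' 0%N (- j%:Z).
Proof.
apply: contrapT => /existsNP[j0 /eqP nj0].
have [m Hm] := choice tower.
pose size_left i N := size (subst_word (F (s i)) (subword (T i.+1) (- N%:Z) N)).
(* Agreement on [N] letters left of the supertile gives agreement on their images and on the [m i]
   letters between these and the origin's tile. *)
have propagate i N : (forall j, (0 < j <= N)%N -> T i.+1 (- j%:Z) = T' i.+1 (- j%:Z)) ->
    forall j, (j <= m i + size_left i N)%N -> T i (- j%:Z) = T' i (- j%:Z).
  move=> agree j jle; have [mn -> -> _] := Hm i; rewrite /shift.
  have [jm|mj] := leqP j (m i).
    rewrite (_ : - j%:Z + (m i)%:Z = (m i - j)%N%:Z); last by lia.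
    by apply: letter_eq; lia.
  rewrite (_ : - j%:Z + (m i)%:Z = - (j - m i)%N%:Z); last by lia.
  apply: (@subst_agree_left _ _ _ _ N); last by rewrite -/(size_left i N); lia.
  apply/subword_eqP => d dN; rewrite (_ : - N%:Z + d%:Z = - (N - d)%N%:Z); last by lia.
  by apply: agree; lia.
have size_left_ge i N : (N <= size_left i N)%N.
  by rewrite /size_left -[X in (X <= _)%N](size_subword (T i.+1) (- N%:Z)) size_subst_word.
have ex i : exists j, T i (- j%:Z) != T' i (- j%:Z).
  elim: i => [|i [j nj]]; first by exists j0.
  apply: contrapT => H; move/eqP: nj; apply; apply: (propagate i j).
    by move=> d _; apply/eqP; apply: contrapT => /negP nd; apply: H; exists d.
  by rewrite (leq_trans (size_left_ge i j)) ?leq_addl.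
pose p i := ex_minn (ex i).
have pP i : T i (- (p i)%:Z) != T' i (- (p i)%:Z).
  by rewrite /p; case: ex_minnP.
have pmin i j : (j < p i)%N -> T i (- j%:Z) = T' i (- j%:Z).
  rewrite /p; case: ex_minnP => v _ vmin jv; apply/eqP.
  by apply: contraTT jv => /vmin; rewrite -leqNgt.
have p0 i : (0 < p i)%N.
  by rewrite lt0n; apply: contraNneq (pP i) => ->; rewrite oppr0 letter0.
have pe i : (m i + size_left i (p i.+1).-1 < p i)%N.
  rewrite ltnNge; apply/negP => le; move/eqP: (pP i); apply.
  apply: propagate le => j jp; apply: pmin; have := p0 i.+1; lia.
apply: (@bounded_disagreement s p m t (fun i => T i 0) (fun i => T i (-1)) grow).
- by move=> i; have := pe i; have := size_left_ge i (p i.+1).-1; have := p0 i.+1; lia.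
(* A constant [p] leaves no slack: [m i = 0], and the [p i - 1] agreeing letters have images of
   total length [p i - 1], so each image has length one. *)
- move=> i pp p1; have := pe i; have := size_left_ge i (p i.+1).-1.
  rewrite -pp => sl pei; have m0 : m i = 0%N by lia.
  have {pei}sl' : size_left i (p i).-1 = (p i).-1 by lia.
  have [q qE] : exists q, (p i).-1 = q.+1 by exists (p i).-2; lia.
  have sf : size (F (s i) (T i.+1 (-1))) = 1%N.
    apply/eqP; rewrite eqn_leq subst_letter_gt0 andbT.
    move: sl'; rewrite qE /size_left -[q.+1]addn1 subword_cat.
    rewrite (_ : - (q + 1)%N%:Z + q%:Z = -1); last by lia.
    rewrite subword1 subst_word_cat subst_word1 size_cat.
    have := size_subst_word (F (s i)) (subword (T i.+1) (- (q + 1)%N%:Z) q).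
    by rewrite size_subword; lia.
  have [_ TE _ _] := Hm i; rewrite m0 in TE.
  have := subword_subst_left (F (s i)) (T i.+1) 1.
  rewrite subword1 subst_word1 sf subword1 => <-.
  by rewrite TE /shift.
- move=> i m0; have [_ TE _ tE] := Hm i; rewrite m0 in TE tE.
  split; first by rewrite tE subr0.
  move=> n1; have := subword_subst_right (F (s i)) (T i.+1) 1.
  by rewrite subword1 subst_word1 n1 subword1 => <-; rewrite TE /shift.
- exact: p0.
(* A disagreement at distance 1 would be seen if [t i < eps]. *)
- move=> i p1; rewrite leNgt; apply/negP => te; have [_ /(_ te) E _] := view i.
  by move/eqP: (pP i); rewrite p1.
- by move=> i; have /andP[_ /ltW] := t01 i.
Qed.

(** The mirror image of the left side, with distance [1 - t i] and [n i - 1 - m i] tiles remaining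
    in the supertile. Position 0 belongs to this half, so the length [n i] enters the counts. *)
Lemma tower_agree_right : forall j : nat, T 0%N j%:Z = T' 0%N j%:Z.
Proof.
apply: contrapT => /existsNP[j0 /eqP nj0].
have [m Hm] := choice tower.
pose size_right i N := size (subst_word (F (s i)) (subword (T i.+1) 1 N)).
have size_rightE i N :
    size (subst_word (F (s i)) (subword (T i.+1) 0 N.+1)) = (n i + size_right i N)%N.
  by rewrite -[N.+1]add1n subword_cat subword1 subst_word_cat subst_word1 size_cat.
have propagate i N : (forall j, (0 < j <= N)%N -> T i.+1 j%:Z = T' i.+1 j%:Z) ->
    forall j, (j + m i < n i + size_right i N)%N -> T i j%:Z = T' i j%:Z.
  move=> agree j jle; have [mn -> -> _] := Hm i; rewrite /shift.
  apply: (@subst_agree_right _ _ _ _ N.+1); last by rewrite size_rightE.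
  apply/subword_eqP => -[|d] dN; rewrite !add0r; first exact: letter0.
  exact: agree.
have size_right_ge i N : (N <= size_right i N)%N.
  by rewrite /size_right -[X in (X <= _)%N](size_subword (T i.+1) 1) size_subst_word.
have mn i : (m i < n i)%N by have [] := Hm i.
have ex i : exists j : nat, T i j%:Z != T' i j%:Z.
  elim: i => [|i [j nj]]; first by exists j0.
  apply: contrapT => H; move/eqP: nj; apply; apply: (propagate i j).
    by move=> d _; apply/eqP; apply: contrapT => /negP nd; apply: H; exists d.
  by have := size_right_ge i j; have := mn i; lia.
pose p i := ex_minn (ex i).
have pP i : T i (p i)%:Z != T' i (p i)%:Z.
  by rewrite /p; case: ex_minnP.
have pmin i j : (j < p i)%N -> T i j%:Z = T' i j%:Z.
  rewrite /p; case: ex_minnP => v _ vmin jv; apply/eqP.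
  by apply: contraTT jv => /vmin; rewrite -leqNgt.
have p0 i : (0 < p i)%N.
  by rewrite lt0n; apply: contraNneq (pP i) => ->; rewrite letter0.
have pe i : (n i + size_right i (p i.+1).-1 <= p i + m i)%N.
  rewrite leqNgt; apply/negP => le; move/eqP: (pP i); apply.
  apply: propagate le => j jp; apply: pmin; have := p0 i.+1; lia.
apply: (@bounded_disagreement s p (fun i => (n i).-1 - m i)%N (fun i => 1 - t i)
  (fun i => T i 0) (fun i => T i 1) grow).
- move=> i; have := pe i; have := size_right_ge i (p i.+1).-1.
  by have := p0 i.+1; have := mn i; lia.
- move=> i pp p1; have := pe i; have := size_right_ge i (p i.+1).-1; have := mn i.
  rewrite -pp => mni sr pei; have m0 : n i = (m i).+1 by lia.
  have {pei}sr' : size_right i (p i).-1 = (p i).-1 by lia.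
  have [q qE] : exists q, (p i).-1 = q.+1 by exists (p i).-2; lia.
  have sf : size (F (s i) (T i.+1 1)) = 1%N.
    apply/eqP; rewrite eqn_leq subst_letter_gt0 andbT.
    move: sr'; rewrite qE /size_right -[q.+1]add1n subword_cat.
    rewrite subword1 subst_word_cat subst_word1 size_cat.
    set w := subword _ _ q; have := size_subst_word (F (s i)) w.
    by rewrite {1}/w size_subword; lia.
  have [_ TE _ _] := Hm i.
  have := subword_subst_right (F (s i)) (T i.+1) 2.
  rewrite -[subword (T i.+1) 0 2]/([:: T i.+1 0 : A] ++ [:: T i.+1 1 : A]).
  rewrite subst_word_cat !subst_word1 size_cat sf subword_cat subword1.
  move=> /eqP; rewrite eqseq_cat ?size_subword // => /andP[_ /eqP <-].
  by rewrite TE /shift m0; congr [:: subst_biinf _ _ _]; lia.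
(* From [m i + 1 = n i] follows [1 - t i = n i * (1 - t i.+1)]. *)
- move=> i e0; have [_ TE _ tE] := Hm i; have m0 : n i = (m i).+1 by have := mn i; lia.
  split.
    have nR : (n i)%:R = (m i)%:R + 1 :> R by rewrite m0 natr1.
    by rewrite tE mulrBr mulr1; move: (_ * t i.+1) => u; lra.
  move=> n1; have m00 : m i = 0%N by lia.
  have := subword_subst_right (F (s i)) (T i.+1) 1.
  by rewrite subword1 subst_word1 n1 subword1 => <-; rewrite TE /shift m00.
- exact: p0.
- move=> i p1; rewrite leNgt; apply/negP => te; have [_ _ Vr] := view i.
  by move/eqP: (pP i); rewrite p1; apply; apply: Vr; lra.
- by move=> i; have /andP[+ _] := t01 i; lra.
Qed.

Lemma tower_eq : T 0%N = T' 0%N.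
Proof.
apply/funext => -[j|j]; first exact: tower_agree_right.
exact: (tower_agree_left j.+1).
Qed.

End Tower.

End Border.

(** * The induced maps and the homeomorphism *)

Lemma BD_induced_exists (R : realType) (A : finType) (k : nat)
    (F : 'I_k.+1 -> substitution A) (s : nat -> 'I_k.+1) :
  2 * eps F R < 1 -> mixing F (sshift s) -> growing F (sshift s) ->
  exists g, unique (BD_induced F R s) g.
Proof.
move=> eps_small mix grow; have surj := BD_proj_surj eps_small mix grow.
have [c cK] := choice surj.
(* By [BD_proj_subst] the choice of the preimage does not matter; continuity follows because the
   projection is a quotient map. *)
pose g y := BD_proj (Omega_subst (c y)).
have gp x : g (BD_proj x) = BD_proj (Omega_subst x).
  by apply: BD_proj_subst => //; rewrite cK.
exists g; split; last first.
  move=> g' [_ g'p]; apply/funext => y.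
  by have [x <-] := surj y; rewrite gp g'p.
split; last exact: gp.
apply: (@compact_quotient_continuous (Omega F R (sshift s)) (BD F R (sshift s))
  (BD F R s) (@BD_proj A k F R (sshift s)) g) => //.
- exact: Omega_compact.
- exact: BD_hausdorff.
- exact: BD_proj_continuous.
- rewrite (_ : g \o _ = (@BD_proj A k F R s) \o (@Omega_subst A k F R s)).
    move=> x; apply: continuous_comp; first exact: Omega_subst_continuous.
    exact: BD_proj_continuous.
  by apply/funext => x; exact: gp.
Qed.

Theorem theorem3p6 (R : realType) (A : finType) (k : nat)
    (F : 'I_k.+1 -> substitution A) (s : nat -> 'I_k.+1)
    (Sigma_neq0 : Sigma F s !=set0)
    (prim : primitive F s) (recog : recognisable F R s) :
  exists2 f : forall i, BD F R (iter i.+1 sshift s) -> BD F R (iter i sshift s),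
    forall i, unique (BD_induced F R (iter i sshift s)) (f i) &
    homeomorphic (Omega F R s) (invlim f).

Proof.
pose s_ i := iter i sshift s.
have mix i : mixing F (s_ i) by apply: mixing_shift; exact: primitive_mixing.
have grow i : growing F (s_ i).
  by apply: growing_iter; apply: growing_mixing => //; exact: (mix 0%N).
have [T0 _] := Sigma_neq0.
have eps_small := eps_lt_half R (T0 0 : A) (grow 0%N).
have [f fU] : exists f : forall i, BD F R (s_ i.+1) -> BD F R (s_ i),
    forall i, unique (BD_induced F R (s_ i)) (f i).
  have H i : {g | unique (BD_induced F R (s_ i)) g}.
    apply: cid; apply: BD_induced_exists => //; [exact: (mix i.+1)|exact: (grow i.+1)].
  by exists (fun i => projT1 (H i)) => i; exact: (projT2 (H i)).
exists f => //.
(* Surjectivity gives right inverses [psi] of the substitution maps; recognisability makes them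
   two-sided. *)
have H i : {psi : Omega F R (s_ i) -> Omega F R (s_ i.+1) |
    cancel psi (@Omega_subst A k F R (s_ i))}.
  apply: cid; have surj := @Omega_subst_surj R A k F (s_ i) (mix i.+1) (grow i.+1).
  by have [q qK] := choice surj; exists q.
have [psi psiK] : exists psi : forall i, Omega F R (s_ i) -> Omega F R (s_ i.+1),
    forall i, cancel (psi i) (@Omega_subst A k F R (s_ i)).
  by exists (fun i => projT1 (H i)) => i; exact: (projT2 (H i)).
have phiK i : cancel (@Omega_subst A k F R (s_ i)) (psi i).
  by move=> x; apply: (recog i); exact: psiK.
apply: (@homeomorphic_invlim (fun i => Omega F R (s_ i)) (fun i => BD F R (s_ i))
  (fun i => @Omega_subst A k F R (s_ i)) psi (fun i => @BD_proj A k F R (s_ i)) f) => //.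
- by move=> i x; have [[_ fp] _] := fU i; exact: fp.
- by move=> i; exact: BD_proj_surj.
- exact: Omega_compact.
- by move=> i; exact: BD_hausdorff.
- move=> i; apply: compact_bij_continuous (phiK i) (psiK i).
  + exact: Omega_compact.
  + exact: Omega_hausdorff.
  + exact: Omega_subst_continuous.
- by move=> i; exact: BD_proj_continuous.
(* Equal projections at all levels give two towers of normal forms with equal times and the same
   views. *)
move=> x x' xx'.
pose X z i := Omega_nf (lift_tower psi i z).
have same i := (BD_proj_eqP eps_small _ _).1 (xx' i).
have tE i : (X x i).2 = (X x' i).2 by have [] := same i.
have view i : same_view F (X x i).1 (X x' i).1 (X x i).2 by have [] := same i.
apply: Omega_nf_inj; rewrite -[Omega_nf x]/(X x 0%N) -[Omega_nf x']/(X x' 0%N).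
rewrite [LHS]surjective_pairing [RHS]surjective_pairing tE; congr (_, _).
apply: (@tower_eq R A k F (fun i => (X x i).1) (fun i => (X x' i).1)
  (fun i => (X x i).2) s (grow 0%N)) => // i.
  by have [] := Omega_nfP (lift_tower psi i x).
have [_] := Omega_nfP (lift_tower psi i.+1 x); rewrite -/(X x i.+1) => /andP[t0 t1].
have nfE z : let u := (size (F (s i) ((X z i.+1).1 0)))%:R * (X z i.+1).2 in
    X z i = (shift (Num.floor u) (subst_biinf (F (s i)) (X z i.+1).1),
             u - (Num.floor u)%:~R).
  have <- : s_ i 0%N = s i by rewrite /s_ iter_sshiftE addn0.
  apply: etrans (@Omega_nf_subst R A k F (s_ i) (lift_tower psi i.+1 z)).
  exact: (congr1 (@Omega_nf A k F R (s_ i)) (esym (psiK i (lift_tower psi i z)))).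
have [T0E _ _] := view i.+1.
have := nfE x; have := nfE x'; rewrite -tE -T0E /=.
set n := size _; set u := n%:R * _ => x'E xE.
have n1 : 1 <= n%:R :> R by rewrite ler1n subst_letter_gt0.
have u0 : 0 <= u by rewrite mulr_ge0.
have un : u < n%:R by rewrite gtr_pMr //; lra.
(* The floor of [u] is the index of the origin's tile inside its supertile. *)
have [m mE] : exists m : nat, Num.floor u = m.
  case E : (Num.floor u) => [m|m]; first by exists m.
  by have : 0 <= Num.floor u; [rewrite floor_ge_int|rewrite E].
exists m; rewrite x'E xE mE -pmulrn; split=> //.
have := floor_le u; rewrite mE -pmulrn => /le_lt_trans/(_ un).
by rewrite ltr_nat.
Qed.
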